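(* Given $\delta>0$, there exist two values $C,c>0$, depending only on $\delta$, such that the following holds for all integers $n\ge 1$, $1\le r\le n$, $1\le s\le n$ and $m\ge 1$. Let $\mathbf{A}_1,\ldots,\mathbf{A}_m\in\mathbb{R}^{n\times n}$ be independent random matrices, each having independent $\mathcal{N}(0,1/m)$ entries, and let $\mathcal{A}:\mathbb{R}^{n\times n}\to\mathbb{R}^m$ be the linear map $\mathcal{A}(\mathbf{Z})=(\langle \mathbf{Z},\mathbf{A}_i\rangle_F)_{i=1}^m$. If $m\ge C\, r s\ln(en/s)$, then, with failure probability at most $2\exp(-cm)$, $$(1-\delta)\|\mathbf{Z}\|_F^2\le\|\mathcal{A}(\mathbf{Z})\|_2^2\le(1+\delta)\|\mathbf{Z}\|_F^2\qquad\text{for all }\mathbf{Z}\in\Sigma_{(s)}^{[r]}.$$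
   Context: $\langle \mathbf{X},\mathbf{Y}\rangle_F=\mathrm{tr}(\mathbf{Y}^\top\mathbf{X})$ is the Frobenius inner product and $\|\cdot\|_F$ the Frobenius norm. $\Sigma_{(s)}^{[r]}$ is the set of symmetric matrices $\mathbf{X}\in\mathbb{R}^{n\times n}$ of rank at most $r$ which are $s$-bisparse, i.e., such that for some index set $S\subseteq\{1,\ldots,n\}$ with $|S|=s$ all entries of $\mathbf{X}$ outside $S\times S$ vanish. *)

(* Defs.v *)
From mathcomp Require Import all_boot all_order all_algebra.
From mathcomp Require Import all_classical all_reals all_analysis.

Set Implicit Arguments.
Unset Strict Implicit.
Unset Printing Implicit Defensive.

Import Order.TTheory GRing.Theory Num.Theory.
Import numFieldNormedType.Exports.

Local Open Scope classical_set_scope.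
Local Open Scope ring_scope.

Section frobenius.
Context {R : realType} {n : nat}.

Definition frob_inner (X Y : 'M[R]_n) : R := \tr (Y^T *m X).

(* MathComp-Analysis' own norm on matrices is the sup norm, hence the explicit
   Frobenius and Euclidean norms here. *)
Definition frob_norm (X : 'M[R]_n) : R := Num.sqrt (frob_inner X X).

Definition l2_norm {m : nat} (x : 'rV[R]_m) : R :=
  Num.sqrt (\sum_(i < m) x 0 i ^+ 2).

Definition measurement_map {m : nat} (A : 'I_m -> 'M[R]_n) (Z : 'M[R]_n) :
  'rV[R]_m := \row_(i < m) frob_inner Z (A i).

Definition bisparse (s : nat) (X : 'M[R]_n) : Prop :=
  exists S : {set 'I_n}, #|S| = s /\
    forall i j, ~~ ((i \in S) && (j \in S)) -> X i j = 0.

Definition bisparse_lowrank (s r : nat) : set 'M[R]_n :=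
  [set X | [/\ X^T = X, (\rank X <= r)%N & bisparse s X]].

End frobenius.

Definition borel_mx (R : realType) (n : nat) :=
  g_sigma_algebraType (@open 'M[R]_n).

Section laws.
Context {d : measure_display} {T : measurableType d} {R : realType}.
Variable P : probability T R.

Definition mutually_independent {I : finType} {d' : measure_display}
    {U : measurableType d'} (X : I -> T -> U) : Prop :=
  forall (J : {set I}) (B : I -> set U), (forall i, measurable (B i)) ->
    P (\bigcap_(i in [set` J]) (X i @^-1` B i)) =
    (\prod_(i in J) P (X i @^-1` B i))%E.

(* [v] is the variance, whereas [normal_prob] takes the standard deviation.
   The two laws need only agree on Borel sets: as functions on all sets, the
   pushforward and [normal_prob] take arbitrary values elsewhere. *)
Definition normally_distributed (X : T -> R) (mu v : R) : Prop :=
  measurable_fun setT X /\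
  forall B : set R, measurable B ->
    pushforward P X B = normal_prob mu (Num.sqrt v) B.

End laws.

(* Main.v *)
(** Idea. For a fixed matrix Z the quantity |A(Z)|^2 is a normalised sum of m
independent squares of Gaussians, so Chernoff's bound gives
(1 - eta)|Z|^2 <= |A(Z)|^2 <= (1 + eta)|Z|^2 up to probability
2 exp(- eta^2 m / 256). Given a support S of size s, the matrices of rank at most r
and Frobenius norm at most 1 supported on S x S have an eps-net of cardinality
exp(O(r s)): factor Z = U V with |U| <= 1, |V|^2 <= r, and round V, then U, to
lattices whose meshes are of order 1/sqrt s and 1/sqrt(r s). Rounding with
signs chosen greedily makes the errors of the entries add up in quadrature, and
the integer points that occur lie in an l1-ball of radius O(r s). There are at
most (en/s)^s supports, so a union bound controls all nets at once. Finally, the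
supremum M of |A(.)| over such matrices satisfies
M <= (1 + eta)^2 + 3 M eta, since the difference of two matrices of rank r splits
into two matrices of rank r; hence the near-isometry passes from the net to all
matrices. *)

Require Import Defs.
From HB Require Import structures.
From mathcomp Require Import all_boot all_order all_algebra.
From mathcomp Require Import all_classical all_reals all_analysis.
From mathcomp Require Import measurable_realfun ring lra.

Set Implicit Arguments.
Unset Strict Implicit.
Unset Printing Implicit Defensive.

Import Order.TTheory GRing.Theory Num.Theory.
Import numFieldNormedType.Exports.

Local Open Scope classical_set_scope.
Local Open Scope ring_scope.

(** * Expectations of products of independent variables *)

Section image_density.
Local Open Scope ereal_scope.
Context d d' (T : measurableType d) (U : measurableType d') (R : realType).
Variables (mu : {measure set T -> \bar R}) (nu : {measure set U -> \bar R}).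
Variables (X : T -> U) (G : T -> R) (c : R).
Hypotheses (mX : measurable_fun setT X) (mG : measurable_fun setT G).
Hypothesis G0 : forall x, (0 <= G x)%R.
Hypothesis density : forall B, measurable B ->
  \int[mu]_x (\1_B (X x) * G x)%:E = c%:E * nu B.

Import HBNNSimple.

Let integral_density_nnsfun (h : {nnsfun U >-> R}) :
  \int[mu]_x (h (X x) * G x)%:E = c%:E * \int[nu]_y (h y)%:E.
Proof.
rewrite integralT_nnsfun sintegralE.
transitivity (\int[mu]_x
    (\sum_(r \in range h) (r%:E * (\1_(h @^-1` [set r]) (X x) * G x)%:E))).
  apply: eq_integral => x _; rewrite fimfunE /=.
  rewrite !fsbig_finite//= mulr_suml -sumEFin; apply: eq_bigr => r _.
  by rewrite -EFinM mulrA.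
rewrite ge0_integral_fsum//=; last 2 first.
- move=> r; apply/measurable_EFinP; apply: measurable_funM => //.
  apply: measurable_funM => //; apply: measurableT_comp => //.
- move=> r x _; rewrite -EFinM mulrA.
  rewrite lee_fin mulr_ge0//; apply: nnfun_muleindic_ge0.
rewrite ge0_mule_fsumr; last first.
  by move=> r; exact: nnsfun_mulemu_ge0.
apply: eq_fsbigr => r /=; rewrite inE => -[y _ <-].
rewrite ge0_integralZl//; last 3 first.
- apply/measurable_EFinP/measurable_funM => //; exact: measurableT_comp.
- by move=> x _; rewrite lee_fin mulr_ge0.
- by rewrite lee_fin.
by rewrite density// muleCA.
Qed.

(** The hypothesis [density] says that [X] carries the measure with density [G] to [c] times [nu].
    Linearity extends it from indicators to simple functions, monotone convergence to nonnegative
    measurable ones. It serves with [G] a Gaussian density, with [G] constant, and with [G] a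
    product of independent factors. *)
Lemma ge0_integral_density (f : U -> R) : measurable_fun setT f ->
  (forall y, (0 <= f y)%R) ->
  \int[mu]_x (f (X x) * G x)%:E = c%:E * \int[nu]_y (f y)%:E.
Proof.
move=> mf f0; have mEf : measurable_fun setT (EFin \o f) by exact/measurable_EFinP.
pose h := nnsfun_approx measurableT mEf.
have hf y : (h n y)%:E @[n --> \oo] --> (f y)%:E.
  apply: (@cvg_nnsfun_approx _ _ _ setT measurableT (EFin \o f) mEf _ y) => //.
  by move=> z _ /=; rewrite lee_fin.
have hnd y m n : (m <= n)%N -> (h m y <= h n y)%R.
  by move=> mn; exact/lefP/nd_nnsfun_approx.
have -> : \int[nu]_y (f y)%:E = limn (fun n => \int[nu]_y (h n y)%:E).
  rewrite -monotone_convergence//.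
  - by apply: eq_integral => y _; apply/esym/cvg_lim.
  - by move=> n; apply/measurable_EFinP.
  - by move=> n y _; rewrite lee_fin.
  - by move=> y _ m n mn; rewrite lee_fin hnd.
rewrite -limeMl//; last first.
  apply: ereal_nondecreasing_is_cvgn => m n mn; apply: ge0_le_integral => //.
  - by move=> y _; rewrite lee_fin.
  - exact/measurable_EFinP.
  - exact/measurable_EFinP.
  - by move=> y _; rewrite lee_fin hnd.
rewrite [X in limn X](_ : _ = fun n => \int[mu]_x (h n (X x) * G x)%:E); last first.
  by apply/funext => n; rewrite /= -integral_density_nnsfun.
rewrite -monotone_convergence//; last 3 first.
- by move=> n; apply/measurable_EFinP/measurable_funM => //; exact: measurableT_comp.
- by move=> n y _; rewrite lee_fin mulr_ge0.
- by move=> y _ m n mn; rewrite lee_fin ler_wpM2r// hnd.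
apply: eq_integral => x _; apply/esym/cvg_lim => //.
under eq_fun do rewrite EFinM.
by rewrite EFinM; apply: cvgeMr.
Qed.

End image_density.

Section independence.
Local Open Scope ereal_scope.
Context d d' (T : measurableType d) (U : measurableType d') (R : realType).
Variables (P : probability T R) (I : finType) (X : I -> T -> U).
Hypotheses (mX : forall i, measurable_fun setT (X i)).
Hypothesis indX : mutually_independent P X.

(** Independence speaks of events only, so indicators are upgraded to functions one index at a time.
    The list [s] contains the indices where [g i] may still be arbitrary; at the head [k] the other
    factors act as a density [G], and only indicators need testing there. *)
Let indep_expectation_prod_aux (s : seq I) (g : I -> U -> R) (e : I -> R) :
  (forall i, measurable_fun setT (g i)) -> (forall i y, (0 <= g i y)%R) ->
  (forall i, \int[P]_x (g i (X i x))%:E = (e i)%:E) ->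
  (forall i, i \notin s -> exists2 B, measurable B & g i = \1_B) ->
  \int[P]_x (\prod_i g i (X i x))%:E = (\prod_i e i)%:E.
Proof.
elim: s g e => [|k s ih] g e mg g0 ge gs.
  (* With [s] empty every factor is an indicator, and the claim is independence for the full index
     set. *)
  have /choice[B mB] : forall i, exists B, measurable B /\ g i = \1_B.
    by move=> i; have [B mB gB] := gs i isT; exists B.
  have gB i y : g i y = \1_(B i) y by rewrite (mB i).2.
  have -> : (\prod_i e i)%:E = \prod_(i in [set: I]%SET) P (X i @^-1` B i).
    rewrite -prodEFin; apply: congr_big => // i; first by rewrite inE.
    move=> _; rewrite -ge; under eq_integral do rewrite gB.
    transitivity (\int[P]_x (\1_(X i @^-1` B i) x)%:E); first by [].
    rewrite integral_indic ?setIT// -[X in measurable X]setTI.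
    by apply: mX => //; exact: (mB i).1.
  rewrite -indX; last by move=> i; exact: (mB i).1.
  transitivity (\int[P]_x (\1_(\bigcap_(i in [set` [set: I]%SET]) (X i @^-1` B i)) x)%:E).
    apply: eq_integral => x _; congr EFin.
    under eq_bigr do rewrite gB.
    rewrite indicE; case: (asboolP (forall i, B i (X i x))) => Bx.
      rewrite mem_set; last by move=> i _; exact: Bx.
      by rewrite big1// => i _; rewrite indicE mem_set//.
    rewrite memNset; last by move=> /= h; apply: Bx => i; apply: h => /=; rewrite inE.
    have [i Bi] := (existsNP _).2 Bx.
    by rewrite (bigD1 i)//= indicE memNset// mul0r.
  rewrite integral_indic ?setIT//.
  apply: fin_bigcap_measurable => // i _; rewrite -[X in measurable X]setTI.
  by apply: mX => //; exact: (mB i).1.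
rewrite (bigD1 k)//= mulrC EFinM -ge.
pose G x := (\prod_(i | i != k) g i (X i x))%R.
under eq_integral do rewrite (bigD1 k)//= -/(G _).
have mG : measurable_fun setT G.
  rewrite (_ : G = fun x => \prod_i (if i != k then g i (X i x) else 1%R))%R; last first.
    by apply/funext => x; exact: big_mkcond.
  by apply: measurable_prod => i _; case: (i != k) => //; exact: measurableT_comp.
have e0 i : (0 <= e i)%R.
  by rewrite -lee_fin -ge; apply: integral_ge0 => x _; rewrite lee_fin.
rewrite (@ge0_integral_density _ _ T U R P (pushforward P (X k)) (X k) G
  (\prod_(i | i != k) e i)%R)//.
- by rewrite ge0_integral_pushforward//; [exact/measurable_EFinP|move=> ? _; rewrite lee_fin].
- by move=> x; apply: prodr_ge0.
(* Putting [\1_B] in position [k] shortens the list of arbitrary factors, so the induction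
   hypothesis applies. *)
move=> B mB.
pose g' i := if i == k then (\1_B : U -> R) else g i.
pose e' i := if i == k then fine (P (X k @^-1` B)) else e i.
have mXB : measurable (X k @^-1` B).
  by rewrite -[X in measurable X]setTI; exact: mX.
have := ih g' e'; rewrite (bigD1 k)//= /e' eqxx => h.
transitivity (\int[P]_x (\prod_i g' i (X i x))%:E).
  apply: eq_integral => x _; rewrite (bigD1 k)//= /g' eqxx /G; congr (_ * _)%:E.
  by apply: eq_bigr => i /negbTE ->.
rewrite h.
- rewrite EFinM fineK ?fin_num_measure// muleC; congr (_%:E * _).
  by apply: eq_bigr => i /negbTE ->.
- by move=> i; rewrite /g'; case: ifP.
- by move=> i y; rewrite /g'; case: ifP.
- move=> i; rewrite /g'; case: ifP => [/eqP ->|_]; last exact: ge.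
  transitivity (\int[P]_x (\1_(X k @^-1` B) x)%:E); first by [].
  by rewrite integral_indic ?setIT// fineK ?fin_num_measure.
- move=> i iNs; rewrite /g'; case: eqP => [_|/eqP ik]; first by exists B.
  by apply: gs; rewrite inE negb_or ik.
Qed.

Lemma indep_expectation_prod (g : I -> U -> R) (e : I -> R) :
  (forall i, measurable_fun setT (g i)) -> (forall i y, (0 <= g i y)%R) ->
  (forall i, \int[P]_x (g i (X i x))%:E = (e i)%:E) ->
  \int[P]_x (\prod_i g i (X i x))%:E = (\prod_i e i)%:E.
Proof.
move=> mg g0 ge; apply: (@indep_expectation_prod_aux (enum I)) => // i.
by rewrite mem_enum.
Qed.

End independence.

(** * Gaussian concentration *)

Section gaussian_moments.
Local Open Scope ereal_scope.
Context {R : realType}.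
Implicit Types a s l : R.

Lemma ge0_integral_normal_prob (m s : R) (f : R -> R) :
  measurable_fun setT f -> (forall x, (0 <= f x)%R) ->
  \int[normal_prob m s]_x (f x)%:E =
  \int[lebesgue_measure]_x (f x * normal_pdf m s x)%:E.
Proof.
move=> mf f0.
rewrite (@ge0_integral_density _ _ _ _ R lebesgue_measure (normal_prob m s) id
  (normal_pdf m s) 1%R)//.
- by rewrite mul1e.
- exact: measurable_normal_pdf.
- by move=> x; exact: normal_pdf_ge0.
move=> B mB; rewrite mul1e /normal_prob [RHS]integral_mkcond /=.
apply: eq_integral => x _.
rewrite patchE indicE; case: ifPn => xB; first by rewrite mul1r.
by rewrite mul0r.
Qed.

(** Completing the square turns the integrand into a constant times the density with mean
    [a * s ^+ 2]. *)
Lemma expectation_expR_normal s a : s != 0%R ->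
  \int[normal_prob 0%R s]_x (expR (a * x))%:E = (expR (a ^+ 2 * s ^+ 2 / 2))%:E.
Proof.
move=> s0; rewrite ge0_integral_normal_prob; last 2 first.
- by apply: measurableT_comp => //; exact: measurable_funM.
- by move=> x; exact: expR_ge0.
rewrite -[RHS]mule1 -(integral_normal_pdf (a * s ^+ 2) s) -ge0_integralZl_EFin //.
- apply: eq_integral => x _; rewrite -EFinM; congr EFin.
  rewrite !normal_pdfE// /normal_fun mulrCA [RHS]mulrCA; congr (_ * _)%R.
  by rewrite -!expRD; congr expR; field.
- by move=> x _; rewrite lee_fin normal_pdf_ge0.
- by apply/measurable_EFinP; exact: measurable_normal_pdf.
Qed.

(** The exponential factor changes the standard density into [q^-1] times the centred density of
    standard deviation [q^-1], where [q ^+ 2 = 1 - 2 * l]. *)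
Lemma expectation_expR_sqr_normal l : (l < 1 / 2)%R ->
  \int[normal_prob 0%R 1%R]_x (expR (l * x ^+ 2))%:E = ((Num.sqrt (1 - 2 * l))^-1)%:E.
Proof.
move=> l12; have l0 : (0 < 1 - 2 * l)%R by lra.
rewrite ge0_integral_normal_prob; last 2 first.
- by apply: measurableT_comp => //; exact: measurable_funM.
- by move=> x; exact: expR_ge0.
set q := Num.sqrt _; have q0 : (0 < q)%R by rewrite sqrtr_gt0.
have qV0 : (q^-1 != 0)%R by rewrite invr_eq0 gt_eqF.
have q2 : (q ^+ 2 = 1 - 2 * l)%R by rewrite sqr_sqrtr// ltW.
rewrite -[RHS]mule1 -(integral_normal_pdf 0%R q^-1) -ge0_integralZl_EFin //.
- apply: eq_integral => x _; rewrite -EFinM; congr EFin.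
  rewrite !normal_pdfE ?oner_eq0// /normal_fun mulrCA [RHS]mulrA; congr (_ * _)%R.
    rewrite /normal_peak expr1n mul1r -mulrnAr sqrtrM ?sqr_ge0// sqrtr_sqr.
    by rewrite gtr0_norm ?invr_gt0// invfM invrK mulrA mulVf ?gt_eqF// mul1r.
  rewrite -expRD; congr expR; rewrite exprVn q2.
  by field; rewrite gt_eqF.
- by move=> x _; rewrite lee_fin normal_pdf_ge0.
- by apply/measurable_EFinP; exact: measurable_normal_pdf.
by rewrite invr_ge0 ltW.
Qed.

End gaussian_moments.

(** * Exponential moments of the square of a standard Gaussian *)

Section square_of_gaussian.
Local Open Scope ereal_scope.
Context d (T : measurableType d) (R : realType) (P : probability T R).
Variable X : T -> R.
Hypothesis mX : measurable_fun setT X.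
Hypothesis mgfX : forall t : R, \int[P]_w (expR (t * X w))%:E = (expR (t ^+ 2 / 2))%:E.

(* [expR (l * x ^+ 2)] is the moment generating function of an auxiliary
   standard normal variable evaluated at [Num.sqrt (2 * l) * x]; Tonelli then
   reduces the left-hand side to the linear exponential moments of [X]. *)
Lemma expectation_expR_sqr (l : R) : (0 <= l < 1 / 2)%R ->
  \int[P]_w (expR (l * X w ^+ 2))%:E = ((Num.sqrt (1 - 2 * l))^-1)%:E.
Proof.
move=> /andP[l0 l12]; set q := Num.sqrt (2 * l).
have q2 : (q ^+ 2 = 2 * l)%R by rewrite sqr_sqrtr// mulr_ge0.
rewrite -expectation_expR_sqr_normal//.
pose f (z : T * R) := (expR (q * X z.1 * z.2))%:E.
transitivity (\int[P]_w \int[normal_prob 0%R 1%R]_h f (w, h)).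
  apply: eq_integral => w _; rewrite /f /=.
  rewrite expectation_expR_normal.
    2: exact: oner_neq0.
  by congr (expR _)%:E; rewrite exprMn q2 expr1n; field.
rewrite fubini_tonelli//.
- apply: eq_integral => h _; rewrite /f/=.
  under eq_integral do rewrite mulrAC.
  by rewrite mgfX; congr (expR _)%:E; rewrite exprMn q2; field.
- apply/measurable_EFinP/measurableT_comp => //.
  apply: measurable_funM => //; apply: measurable_funM => //.
  exact: (measurableT_comp mX).
by move=> z; rewrite lee_fin expR_ge0.
Qed.

(** After squaring, [expR u >= 1 + u] reduces the bound to a polynomial inequality in [l]. The
    coefficient 64 is the one that the opposite sign produces below. *)
Lemma expectation_expR_sqr_ub (l : R) : (0 <= l <= 1 / 8)%R ->
  \int[P]_w (expR (l * X w ^+ 2))%:E <= (expR (l + 64 * l ^+ 2))%:E.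
Proof.
move=> /andP[l0 l8]; rewrite expectation_expR_sqr ?l0/=; last by lra.
rewrite lee_fin -[leLHS]mul1r ler_pdivrMr ?sqrtr_gt0; last by lra.
rewrite -ler_sqr ?nnegrE ?mulr_ge0 ?expR_ge0 ?sqrtr_ge0//.
rewrite exprMn sqr_sqrtr; last by lra.
rewrite expr1n -expRM_natl.
have := expR_ge1Dx (2%:R * (l + 64 * l ^+ 2))%R.
set u := expR _; move=> hu.
have h : (1 <= (1 + 2%:R * (l + 64 * l ^+ 2)) * (1 - 2 * l))%R by nra.
by apply: (le_trans h); rewrite ler_pM2r//; lra.
Qed.

(** The exact formula covers only [l >= 0]. The negative exponent is therefore bounded together with
    the positive one, whose expectation, at least [1 + l], is then subtracted. *)
Lemma expectation_expR_oppsqr_ub (l : R) : (0 <= l <= 1 / 8)%R ->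
  \int[P]_w (expR (- l * X w ^+ 2))%:E <= (expR (- l + 64 * l ^+ 2))%:E.
Proof.
move=> /andP[l0 l8].
have mE (a : R) : measurable_fun setT (fun w => expR (a * X w ^+ 2)).
  by apply: measurableT_comp => //; apply: measurable_funM => //; exact: measurable_funX.
(* With [u = l * y], the sum is [2 + expR u * (1 - expR (- u)) ^+ 2], at most [2 + u ^+ 2 * expR u].
   Then [y ^+ 2 / 32 <= expR (y / 4)] and [expR u <= expR (y / 8)] give the exponent 3/8, still
   below 1/2. *)
have key x : (expR (- l * x ^+ 2) + expR (l * x ^+ 2) <=
              2 + 32 * l ^+ 2 * expR (3 / 8 * x ^+ 2))%R.
  set y := (x ^+ 2)%R; have y0 : (0 <= y)%R by exact: sqr_ge0.
  have h1 : (1 + (- (l * y)) <= expR (- (l * y)))%R := expR_ge1Dx _.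
  have h2 : (expR (- (l * y)) <= 1)%R by rewrite -[leRHS]expR0 ler_expR oppr_le0 mulr_ge0.
  have h3 : (expR (l * y) * expR (- (l * y)) = 1)%R by rewrite -expRD subrr expR0.
  have h4 : (1 + (y / 4) ^+ 2 / 2 <= expR (y / 4))%R.
    by apply: (le_trans _ (expR_ge1Dxn 1 _)); rewrite ?divr_ge0.
  have h5 : (expR (l * y) <= expR (y / 8))%R by rewrite ler_expR; nra.
  have -> : expR (3 / 8 * y) = (expR (y / 4) * expR (y / 8))%R.
    by rewrite -expRD; congr expR; lra.
  rewrite mulNr; set p := expR (l * y) in h3 h5 *; set n := expR (- (l * y)) in h1 h2 h3 *.
  have p0 : (0 < p)%R by exact: expR_gt0.
  have -> : (n + p = 2 + p * (1 - n) ^+ 2)%R.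
    have -> : (p * (1 - n) ^+ 2 = p - 2 * (p * n) + (p * n) * n)%R by ring.
    by rewrite h3; ring.
  rewrite lerD2l (@le_trans _ _ (p * (l * y) ^+ 2)%R)//.
    by rewrite ler_pM2l// ler_sqr ?nnegrE; [lra|lra|rewrite mulr_ge0].
  have -> : (p * (l * y) ^+ 2 = 32 * l ^+ 2 * ((y / 4) ^+ 2 / 2 * p))%R by field.
  rewrite ler_wpM2l ?mulr_ge0 ?sqr_ge0//.
  apply: ler_pM => //; [by rewrite divr_ge0 ?sqr_ge0|exact: ltW|lra].
have v38 : \int[P]_w (expR (3 / 8 * X w ^+ 2))%:E = 2%:E.
  rewrite expectation_expR_sqr; last by lra.
  have -> : (1 - 2 * (3 / 8) = (1 / 2) ^+ 2 :> R)%R by field.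
  by rewrite sqrtr_sqr ger0_norm ?divr_ge0// invf_div divr1.
have : \int[P]_w (expR (- l * X w ^+ 2) + expR (l * X w ^+ 2))%:E <=
       (2 + 64 * l ^+ 2)%:E.
  apply: (@le_trans _ _ (\int[P]_w (2 + 32 * l ^+ 2 * expR (3 / 8 * X w ^+ 2))%:E)).
    apply: ge0_le_integral => //.
    - by apply/measurable_EFinP; exact: measurable_funD.
    - by apply/measurable_EFinP/measurable_funD => //; exact: measurable_funM.
    - by move=> w _; rewrite lee_fin.
  under eq_integral do rewrite EFinD EFinM.
  rewrite ge0_integralD//; last 2 first.
  - by move=> w _; rewrite -EFinM lee_fin !mulr_ge0 ?sqr_ge0 ?expR_ge0.
  - apply: measurable_funeM; exact/measurable_EFinP.
  rewrite integral_cst//= probability_setT mule1 ge0_integralZl//; last 2 first.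
  - exact/measurable_EFinP.
  - by rewrite lee_fin mulr_ge0 ?sqr_ge0.
  by rewrite v38 -EFinM -EFinD lee_fin lerD2l; lra.
under eq_integral do rewrite EFinD.
rewrite ge0_integralD//; try exact/measurable_EFinP.
rewrite (@expectation_expR_sqr l); last by lra.
rewrite -leeBrDr// => h; apply: (le_trans h); rewrite -EFinB lee_fin.
apply: (le_trans _ (expR_ge1Dx _)).
have : (1 + l <= (Num.sqrt (1 - 2 * l))^-1)%R.
  rewrite -[leRHS]mul1r ler_pdivlMr ?sqrtr_gt0; last by lra.
  rewrite -ler_sqr ?nnegrE ?mulr_ge0 ?sqrtr_ge0//; last by lra.
  rewrite exprMn sqr_sqrtr; last by lra.
  by rewrite expr1n; nra.
by lra.
Qed.

End square_of_gaussian.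

Lemma chernoff_bound d (T : measurableType d) (R : realType) (P : probability T R)
    (W : T -> R) (l a b : R) : measurable_fun setT W -> 0 < l ->
  (\int[P]_w (expR (l * W w))%:E <= (expR b)%:E)%E ->
  (P [set w | (a <= W w)%R] <= (expR (b - l * a))%:E)%E.
Proof.
move=> mW l0 h.
pose V : {RV P >-> R} := HB.pack W (isMeasurableFun.Build _ _ _ _ _ mW).
apply: (le_trans (@chernoff _ _ _ P V l a l0)).
rewrite expRD EFinM lee_pmul2r ?lte_fin ?expR_gt0//.
rewrite /mmt_gen_fun unlock /=; apply: le_trans h.
by under eq_integral do rewrite mulrC.
Qed.

Section frobenius_theory.
Context {R : realType} {n : nat}.
Implicit Types X Y Z : 'M[R]_n.

Lemma frob_innerE X Y :
  frob_inner X Y = \sum_(p : 'I_n * 'I_n) X p.1 p.2 * Y p.1 p.2.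
Proof.
rewrite -(pair_bigA _ (fun i j => X i j * Y i j))/= exchange_big/=.
rewrite /frob_inner /mxtrace; apply: eq_bigr => j _; rewrite !mxE.
by apply: eq_bigr => i _; rewrite !mxE mulrC.
Qed.

Lemma sqr_frob_norm X : frob_norm X ^+ 2 = \sum_(p : 'I_n * 'I_n) X p.1 p.2 ^+ 2.
Proof.
rewrite sqr_sqrtr frob_innerE; first by apply: eq_bigr => p _; rewrite expr2.
by apply: sumr_ge0 => p _; rewrite -expr2 sqr_ge0.
Qed.

Lemma sqr_frob_norm_gt0 X : X != 0 -> 0 < frob_norm X ^+ 2.
Proof.
move=> X0; rewrite lt_def sqr_ge0 andbT; apply: contra X0 => /eqP.
rewrite sqr_frob_norm => /psumr_eq0P h; apply/eqP/matrixP => i j.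
by rewrite mxE; apply/eqP; rewrite -sqrf_eq0; apply/eqP/(h _ (i, j)) => // p _; rewrite sqr_ge0.
Qed.

Lemma sqr_l2_norm m (x : 'rV[R]_m) : l2_norm x ^+ 2 = \sum_(i < m) x 0 i ^+ 2.
Proof. by rewrite sqr_sqrtr// sumr_ge0// => i _; rewrite sqr_ge0. Qed.

Lemma sqr_l2_norm_measurement m (A : 'I_m -> 'M[R]_n) Z :
  l2_norm (measurement_map A Z) ^+ 2 = \sum_(i < m) frob_inner Z (A i) ^+ 2.
Proof. by rewrite sqr_l2_norm; apply: eq_bigr => i _; rewrite mxE. Qed.

Lemma measurable_borel_mx_coord i j :
  measurable_fun setT (fun M : borel_mx R n => (M : 'M[R]_n) i j).
Proof.
apply: (measurability (@RGenOpens.G R)); first exact: RGenOpens.measurableE.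
move=> _ [_ [x [y ->]] <-]; rewrite setTI; apply: sub_sigma_algebra.
apply: (open_comp (f := fun M : 'M[R]_n => M i j)); last exact: interval_open.
by move=> M _; exact: coord_continuous.
Qed.

Lemma measurable_borel_mx_frob_inner Z :
  measurable_fun setT (fun M : borel_mx R n => frob_inner Z (M : 'M[R]_n)).
Proof.
under eq_fun do rewrite frob_innerE.
apply: measurable_sum => p; apply: measurable_funM => //.
exact: measurable_borel_mx_coord.
Qed.

End frobenius_theory.

Section gaussian_measurements.
Local Open Scope ereal_scope.
Context {R : realType} {n m : nat} d (T : measurableType d) (P : probability T R).
Variable A : 'I_m -> {RV P >-> borel_mx R n}.
Hypothesis m_gt0 : (0 < m)%N.
Hypothesis A_indep : mutually_independent P (fun i => A i : T -> borel_mx R n).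
Hypothesis A_entries_indep : forall i : 'I_m, mutually_independent P
  (fun (p : 'I_n * 'I_n) (w : T) => (A i w : 'M[R]_n) p.1 p.2).
Hypothesis A_normal : forall (i : 'I_m) (j k : 'I_n),
  normally_distributed P (fun w : T => (A i w : 'M[R]_n) j k) 0 (1 / m%:R).

Let mR : (0 < m%:R :> R)%R. Proof. by rewrite ltr0n. Qed.

Lemma expectation_expR_entry i j k (a : R) :
  \int[P]_w (expR (a * (A i w : 'M[R]_n) j k))%:E =
  (expR (a ^+ 2 / (2 * m%:R)))%:E.
Proof.
have [mX lawX] := A_normal i j k.
transitivity (1%:E * \int[normal_prob 0%R (Num.sqrt (1 / m%:R))]_x (expR (a * x))%:E).
  have E1 w : (expR (a * (A i w : 'M[R]_n) j k) =
      expR (a * (A i w : 'M[R]_n) j k) * cst 1 w)%R by rewrite mulr1.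
  under eq_integral do rewrite E1.
  apply: (@ge0_integral_density _ _ T (measurableTypeR R) R P (normal_prob 0%R (Num.sqrt (1 / m%:R)))
(fun w => (A i w : 'M[R]_n) j k) (cst 1%R) 1%R mX _ _ _
    (fun x : R => expR (a * x))%R) => //.
  - move=> B mB; rewrite mul1e; apply: etrans (lawX _ mB).
    have mXB : measurable ((fun w => (A i w : 'M[R]_n) j k) @^-1` B).
      by rewrite -[X in measurable X]setTI; exact: mX.
    transitivity (\int[P]_w (\1_((fun w => (A i w : 'M[R]_n) j k) @^-1` B) w)%:E).
      by apply: eq_integral => w _; rewrite mulr1.
    by rewrite integral_indic// setIT.
  - by apply: measurableT_comp => //; exact: measurable_funM.
rewrite mul1e.
rewrite expectation_expR_normal; last by rewrite gt_eqF// sqrtr_gt0 divr_gt0.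
rewrite sqr_sqrtr ?divr_ge0// ?ltW//; congr (expR _)%:E.
by field; rewrite gt_eqF.
Qed.

(** This is the moment generating function of a centred Gaussian of variance
    [frob_norm Z ^+ 2 / m%:R]; independence of the entries factorises the exponential. *)
Lemma expectation_expR_frob_inner i Z (t : R) :
  \int[P]_w (expR (t * frob_inner Z (A i w : 'M[R]_n)))%:E =
  (expR (t ^+ 2 * frob_norm Z ^+ 2 / (2 * m%:R)))%:E.
Proof.
transitivity (\int[P]_w (\prod_(p : 'I_n * 'I_n)
    expR (t * Z p.1 p.2 * (A i w : 'M[R]_n) p.1 p.2))%:E).
  apply: eq_integral => w _; rewrite -expR_sum frob_innerE mulr_sumr.
  by congr (expR _)%:E; apply: eq_bigr => p _; rewrite mulrA.
rewrite (@indep_expectation_prod _ _ _ _ _ _ _ _ _ (A_entries_indep i)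
    (fun p y => expR (t * Z p.1 p.2 * y))
    (fun p => expR ((t * Z p.1 p.2) ^+ 2 / (2 * m%:R)))).
- rewrite -expR_sum sqr_frob_norm mulr_sumr mulr_suml; congr (expR _)%:E.
  by apply: eq_bigr => p _; rewrite exprMn.
- by move=> p; exact: (A_normal i p.1 p.2).1.
- by move=> p; apply: measurableT_comp => //; exact: measurable_funM.
- by move=> p y; exact: expR_ge0.
- by move=> p; exact: expectation_expR_entry.
Qed.

Lemma measurable_sqr_l2_norm_measurement Z :
  measurable_fun setT
    (fun w => l2_norm (measurement_map (fun i => A i w : 'M[R]_n) Z) ^+ 2)%R.
Proof.
under eq_fun do rewrite sqr_l2_norm_measurement.
apply: measurable_sum => i; apply: measurable_funX.
apply: (measurableT_comp (measurable_borel_mx_frob_inner Z)).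
exact: measurable_funP.
Qed.

(** Both tails share this step, so [l] may have either sign. Rescaled by [q], each inner product has
    the standard Gaussian moment generating function; the bound [lb] applies to it and independence
    multiplies the [m] bounds. *)
Let measurement_tail (Z : 'M[R]_n) (l b : R) : Z != 0%R -> 
  (forall X : T -> R, measurable_fun setT X ->
    (forall t : R, \int[P]_w (expR (t * X w))%:E = (expR (t ^+ 2 / 2))%:E) ->
    \int[P]_w (expR (l * X w ^+ 2))%:E <= (expR b)%:E) ->
  \int[P]_w (expR (l * m%:R / frob_norm Z ^+ 2 *
    l2_norm (measurement_map (fun i => A i w : 'M[R]_n) Z) ^+ 2))%:E
  <= (expR (m%:R * b))%:E.
Proof.
move=> Z0 lb; set S := (frob_norm Z ^+ 2)%R.
have S0 : (0 < S)%R := sqr_frob_norm_gt0 Z0.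
pose q := Num.sqrt (m%:R / S).
have q2 : (q ^+ 2 = m%:R / S)%R by rewrite sqr_sqrtr// divr_ge0// ltW.
pose X i w := (q * frob_inner Z (A i w : 'M[R]_n))%R.
have mX i : measurable_fun setT (X i).
  apply: measurable_funM => //.
  apply: (measurableT_comp (measurable_borel_mx_frob_inner Z)).
  exact: measurable_funP.
have XE i (t : R) : \int[P]_w (expR (t * X i w))%:E = (expR (t ^+ 2 / 2))%:E.
  under eq_integral do rewrite mulrA.
  rewrite expectation_expR_frob_inner exprMn q2 -/S; congr (expR _)%:E.
  by field; rewrite !gt_eqF.
pose e i := fine (\int[P]_w (expR (l * X i w ^+ 2))%:E).
have eE i : \int[P]_w (expR (l * X i w ^+ 2))%:E = (e i)%:E.
  rewrite fineK// ge0_fin_numE; last first.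
    by apply: integral_ge0 => w _; rewrite lee_fin expR_ge0.
  exact: (le_lt_trans (lb _ (mX i) (XE i)) (ltry _)).
have -> : \int[P]_w (expR (l * m%:R / S *
    l2_norm (measurement_map (fun i => A i w : 'M[R]_n) Z) ^+ 2))%:E =
    \int[P]_w (\prod_i expR (l * X i w ^+ 2))%:E.
  apply: eq_integral => w _; rewrite -expR_sum -mulr_sumr.
  rewrite sqr_l2_norm_measurement; congr (expR _)%:E.
  under [in RHS]eq_bigr do rewrite exprMn q2.
  by rewrite -mulr_sumr !mulrA.
rewrite (@indep_expectation_prod _ _ _ _ _ _ _ _ _ A_indep
    (fun i (M : borel_mx R n) => expR (l * (q * frob_inner Z (M : 'M[R]_n)) ^+ 2)) e)//.
- have -> : (m%:R * b = \sum_(i < m) b)%R by rewrite sumr_const card_ord mulr_natl.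
  rewrite expR_sum lee_fin; apply: ler_prod => i _.
  rewrite -!lee_fin -eE lb// andbT.
  by apply: integral_ge0 => w _; rewrite lee_fin expR_ge0.
- move=> i; apply: measurableT_comp => //; apply: measurable_funM => //.
  apply: measurable_funX; apply: measurable_funM => //.
  exact: measurable_borel_mx_frob_inner.
Qed.

Lemma gaussian_concentration (Z : 'M[R]_n) (eta : R) : (0 < eta <= 1)%R ->
  P (~` [set w : T | ((1 - eta) * frob_norm Z ^+ 2 <=
          l2_norm (measurement_map (fun i => A i w : 'M[R]_n) Z) ^+ 2 <=
        (1 + eta) * frob_norm Z ^+ 2)%R])
  <= (2 * expR (- (eta ^+ 2 / 256 * m%:R)))%:E.
Proof.
move=> /andP[eta0 eta1].
set N := fun w => (l2_norm (measurement_map (fun i => A i w : 'M[R]_n) Z) ^+ 2)%R.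
have mN : measurable_fun setT N by exact: measurable_sqr_l2_norm_measurement.
set S := (frob_norm Z ^+ 2)%R.
have [Z0|Z0] := eqVneq Z 0%R.
  rewrite [X in P X](_ : _ = set0) ?measure0 ?lee_fin ?mulr_ge0 ?expR_ge0//.
  apply/seteqP; split=> // w; apply; rewrite /= /S Z0 sqr_frob_norm sqr_l2_norm_measurement.
  rewrite !big1 ?mulr0 ?lexx//.
    by move=> i _; rewrite frob_innerE big1 ?expr0n// => p _; rewrite mxE mul0r.
  by move=> p _; rewrite mxE expr0n.
have S0 : (0 < S)%R := sqr_frob_norm_gt0 Z0.
(* This [l] minimises [64 * l ^+ 2 - l * eta], the exponent per measurement in both tails; the
   minimum is [- eta ^+ 2 / 256]. *)
pose l := (eta / 128)%R.
have l8 : (0 <= l <= 1 / 8)%R by rewrite /l; lra.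
have l_gt0 : (0 < l * m%:R / S)%R by rewrite !mulr_gt0 ?invr_gt0//; lra.
have up : P [set w | ((1 + eta) * S <= N w)%R] <= (expR (- (eta ^+ 2 / 256 * m%:R)))%:E.
  have := @measurement_tail Z l (l + 64 * l ^+ 2)%R Z0
    (fun X mX XE => expectation_expR_sqr_ub mX XE l8).
  move=> /(chernoff_bound ((1 + eta) * S)%R mN l_gt0) /le_trans; apply.
  by rewrite lee_fin ler_expR le_eqVlt; apply/orP; left; apply/eqP; rewrite /l; field; rewrite gt_eqF.
have mNN : measurable_fun setT (fun w => - N w)%R by exact: measurableT_comp.
have dn : P [set w | (- ((1 - eta) * S) <= - N w)%R] <= (expR (- (eta ^+ 2 / 256 * m%:R)))%:E.
  have := @measurement_tail Z (- l) (- l + 64 * l ^+ 2)%R Z0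
    (fun X mX XE => expectation_expR_oppsqr_ub mX XE l8).
  rewrite -/N; under eq_integral do rewrite !mulNr -mulrN.
  move=> /(chernoff_bound (- ((1 - eta) * S))%R mNN l_gt0) /le_trans; apply.
  by rewrite lee_fin ler_expR le_eqVlt; apply/orP; left; apply/eqP; rewrite /l; field; rewrite gt_eqF.
have mup : measurable [set w | ((1 + eta) * S <= N w)%R].
  by rewrite -[X in measurable X]setTI; apply: measurable_fun_le.
have mdn : measurable [set w | (- ((1 - eta) * S) <= - N w)%R].
  by rewrite -[X in measurable X]setTI; apply: measurable_fun_le.
apply: (@le_trans _ _ (P ([set w | ((1 + eta) * S <= N w)%R] `|`
    [set w | (- ((1 - eta) * S) <= - N w)%R]))).
  apply: le_measure; rewrite ?inE.
  - apply: measurableC; rewrite -[X in measurable X]setTI.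
    rewrite (_ : [set w | _] = [set w | ((1 - eta) * S <= N w)%R] `&`
                               [set w | (N w <= (1 + eta) * S)%R]); last first.
      by apply/seteqP; split=> w /= => [/andP[]|[-> ->]].
    rewrite setTI; apply: measurableI.
      by rewrite -[X in measurable X]setTI; apply: measurable_fun_le.
    by rewrite -[X in measurable X]setTI; apply: measurable_fun_le.
  - exact: measurableU.
  move=> w /= /negP; rewrite negb_and -!ltNge => /orP[h|h].
    by right; rewrite lerN2 ltW.
  by left; rewrite ltW.
apply: (le_trans (measureU2 _ _ _)) => //.
by rewrite mulr_natl mulr2n EFinD leeD.
Qed.

End gaussian_measurements.

(** * Matrices of low rank *)

Section euclidean_norm.
Context {R : rcfType} {I : finType}.
Implicit Types f g : I -> R.

Definition enorm f := Num.sqrt (\sum_i f i ^+ 2).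

Lemma enorm_ge0 f : 0 <= enorm f.
Proof. exact: sqrtr_ge0. Qed.

Lemma sqr_enorm f : enorm f ^+ 2 = \sum_i f i ^+ 2.
Proof. by rewrite sqr_sqrtr// sumr_ge0// => i _; exact: sqr_ge0. Qed.

Lemma enorm_eq0 f : enorm f = 0 -> forall i, f i = 0.
Proof.
move=> f0 i; have /esym := sqr_enorm f; rewrite f0 expr0n/= => /psumr_eq0P h.
by apply/eqP; rewrite -sqrf_eq0; apply/eqP/h => // j _; exact: sqr_ge0.
Qed.

Lemma cauchy_schwarz f g : \sum_i f i * g i <= enorm f * enorm g.
Proof.
set a := enorm f; set b := enorm g; set c := \sum_i _.
have a0 : 0 <= a := enorm_ge0 f.
have : 0 <= b := enorm_ge0 g; rewrite le_eqVlt => /orP[/eqP b0|b0].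
  by rewrite /c big1 ?mulr_ge0// ?enorm_ge0// => i _; rewrite (enorm_eq0 (esym b0)) mulr0.
have : 0 <= \sum_i (b ^+ 2 * f i - c * g i) ^+ 2 by apply: sumr_ge0 => i _; exact: sqr_ge0.
under eq_bigr do rewrite sqrrB !exprMn -mulrnAr.
rewrite big_split/= big_split/= sumrN -!mulr_sumr -!sqr_enorm -/a -/b.
have -> : \sum_i b ^+ 2 * f i * (c * g i *+ 2) = b ^+ 2 * c * c *+ 2.
  under eq_bigr do rewrite mulrnAr mulrACA.
  by rewrite sumrMnl -mulr_sumr -/c.
have [c0 _|c0] := lerP c 0; first by rewrite (le_trans c0)// mulr_ge0// ltW.
rewrite (_ : _ + _ = b ^+ 2 * ((a * b) ^+ 2 - c ^+ 2)); last by ring.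
rewrite pmulr_rge0 ?exprn_gt0// subr_ge0 ler_sqr ?nnegrE ?mulr_ge0//; exact: ltW.
Qed.

Lemma enormD f g : enorm (fun i => f i + g i) <= enorm f + enorm g.
Proof.
rewrite -ler_sqr ?nnegrE ?addr_ge0 ?enorm_ge0// sqr_enorm sqrrD !sqr_enorm.
under eq_bigr do rewrite sqrrD.
rewrite big_split/= big_split/= lerD2r lerD2l sumrMnl ler_pMn2r//.
exact: cauchy_schwarz.
Qed.

Lemma enormZ a f : enorm (fun i => a * f i) = `|a| * enorm f.
Proof.
rewrite /enorm; under eq_bigr do rewrite exprMn.
by rewrite -mulr_sumr sqrtrM ?sqr_ge0// sqrtr_sqr.
Qed.

Lemma sum_norm_le_enorm f : \sum_i `|f i| <= Num.sqrt #|I|%:R * enorm f.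
Proof.
have := cauchy_schwarz (fun=> 1) (fun i => `|f i|).
under eq_bigr do rewrite mul1r.
move=> /le_trans; apply; rewrite /enorm.
under eq_bigr do rewrite expr1n.
under [X in _ * Num.sqrt X]eq_bigr do rewrite real_normK ?num_real//.
by rewrite sumr_const.
Qed.

End euclidean_norm.

Section low_rank_matrices.
Context {R : rcfType}.

Definition fnorm {p q} (X : 'M[R]_(p, q)) : R := enorm (fun k : 'I_p * 'I_q => X k.1 k.2).

Lemma fnorm_ge0 p q (X : 'M[R]_(p, q)) : 0 <= fnorm X.
Proof. exact: enorm_ge0. Qed.

Lemma sqr_fnorm p q (X : 'M[R]_(p, q)) : fnorm X ^+ 2 = \sum_i \sum_j X i j ^+ 2.
Proof. by rewrite sqr_enorm pair_bigA. Qed.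

Lemma fnorm0 p q : fnorm (0 : 'M[R]_(p, q)) = 0.
Proof. by rewrite /fnorm /enorm big1 ?sqrtr0// => k _; rewrite mxE expr0n. Qed.

Lemma fnormD p q (X Y : 'M[R]_(p, q)) : fnorm (X + Y) <= fnorm X + fnorm Y.
Proof.
by rewrite (le_trans _ (enormD _ _))// /fnorm /enorm; under eq_bigr do rewrite mxE.
Qed.

Lemma fnormZ p q a (X : 'M[R]_(p, q)) : fnorm (a *: X) = `|a| * fnorm X.
Proof. by rewrite /fnorm -enormZ /enorm; under eq_bigr do rewrite mxE. Qed.

Lemma fnormN p q (X : 'M[R]_(p, q)) : fnorm (- X) = fnorm X.
Proof. by rewrite -scaleN1r fnormZ normrN1 mul1r. Qed.

Lemma fnorm_tr p q (X : 'M[R]_(p, q)) : fnorm X^T = fnorm X.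
Proof.
apply/eqP; rewrite -(@eqrXn2 _ 2)// ?fnorm_ge0// !sqr_fnorm exchange_big/=; apply/eqP.
by apply: eq_bigr => i _; apply: eq_bigr => j _; rewrite mxE.
Qed.

Lemma fnorm_le_entries p q (X : 'M[R]_(p, q)) (h : R) : 0 <= h ->
  (forall i j, `|X i j| <= h) -> fnorm X ^+ 2 <= h ^+ 2 * (p * q)%:R.
Proof.
move=> h0 Xh; rewrite sqr_enorm.
apply: (@le_trans _ _ (\sum_(k : 'I_p * 'I_q) h ^+ 2)).
  by apply: ler_sum => k _; rewrite -real_normK ?num_real// ler_sqr ?nnegrE.
by rewrite sumr_const card_prod !card_ord mulr_natr.
Qed.

(** For nonzero [Z], [v] is a normalised nonzero row and [u *m v] projects all rows onto [v], so the
    norm identity is Pythagoras. The rank drops since [v] lies both in the row space of [Z] and in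
    the kernel of [1%:M - v^T *m v]. *)
Lemma split_rank_one p q r (Z : 'M[R]_(p, q)) : (\rank Z <= r.+1)%N ->
  exists (u : 'cV[R]_p) (v : 'rV[R]_q),
    [/\ (\rank (Z - u *m v)%R <= r)%N, fnorm v ^+ 2 <= 1 &
        fnorm Z ^+ 2 = fnorm (Z - u *m v) ^+ 2 + fnorm u ^+ 2].
Proof.
move=> rZ; have [->|/matrix0Pn[i [j Zij]]] := eqVneq Z 0.
  exists 0, 0; rewrite mul0mx subr0 mxrank0 !fnorm0 expr0n/= addr0.
  by split=> //; exact: ler01.
set w := row i Z; set nw := fnorm w.
have nw0 : nw != 0.
  by apply: contra Zij => /eqP /enorm_eq0 /(_ (0, j)); rewrite mxE => ->.
pose v := nw^-1 *: w.
have v1 : fnorm v ^+ 2 = 1.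
  by rewrite fnormZ exprMn real_normK ?num_real// -exprMn mulVf// expr1n.
have vZ : (v <= Z)%MS by rewrite scalemx_sub ?row_sub.
clearbody v.
have vv : v *m v^T = 1%:M.
  apply/matrixP => k l; rewrite !ord1 !mxE eqxx mulr1n -[RHS]v1 sqr_fnorm big_ord1.
  by apply: eq_bigr => a _; rewrite mxE expr2.
exists (Z *m v^T), v; split; last 2 first.
- by rewrite v1.
- rewrite !sqr_fnorm -big_split/=; apply: eq_bigr => k _.
  rewrite big_ord1; set c := (Z *m v^T) k 0.
  have cE : c = \sum_l Z k l * v 0 l by rewrite /c mxE; apply: eq_bigr => l _; rewrite mxE.
  have -> : \sum_l (Z - Z *m v^T *m v) k l ^+ 2 =
      \sum_l (Z k l ^+ 2 - c * (Z k l * v 0 l) *+ 2 + c ^+ 2 * v 0 l ^+ 2).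
    apply: eq_bigr => l _; rewrite 2!mxE [X in - X]mxE big_ord1 -/c.
    by ring.
  rewrite big_split/= sumrB sumrMnl -!mulr_sumr -cE.
  have -> : \sum_l v 0 l ^+ 2 = 1 by rewrite -v1 sqr_fnorm big_ord1.
  by ring.
have -> : Z - Z *m v^T *m v = Z *m (1%:M - v^T *m v) by rewrite mulmxBr mulmx1 mulmxA.
have := mxrank_mul_ker Z (1%:M - v^T *m v).
set k := \rank (Z :&: _)%MS; suff k0 : (0 < k)%N.
  by move=> h; rewrite -ltnS (leq_trans _ rZ)// -h -addn1 leq_add2l.
have vk : (v <= Z :&: kermx (1%:M - v^T *m v))%MS.
  rewrite sub_capmx vZ/=; apply/sub_kermxP.
  by rewrite mulmxBr mulmx1 mulmxA vv mul1mx subrr.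
apply: leq_trans (mxrankS vk); rewrite lt0n mxrank_eq0.
by apply: contra_eq_neq v1 => ->; rewrite fnorm0 expr0n eq_sym oner_eq0.
Qed.

Lemma sqr_fnorm_row_mx p q1 q2 (X : 'M[R]_(p, q1)) (Y : 'M[R]_(p, q2)) :
  fnorm (row_mx X Y) ^+ 2 = fnorm X ^+ 2 + fnorm Y ^+ 2.
Proof.
rewrite !sqr_fnorm -big_split/=; apply: eq_bigr => i _; rewrite big_split_ord/=.
by congr (_ + _); apply: eq_bigr => j _; rewrite ?row_mxEl ?row_mxEr.
Qed.

Lemma sqr_fnorm_col_mx p1 p2 q (X : 'M[R]_(p1, q)) (Y : 'M[R]_(p2, q)) :
  fnorm (col_mx X Y) ^+ 2 = fnorm X ^+ 2 + fnorm Y ^+ 2.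
Proof. by rewrite -fnorm_tr tr_col_mx sqr_fnorm_row_mx !fnorm_tr. Qed.

(** A substitute for the singular value decomposition: repeated splitting collects the [u] as
    columns of [U], whose squared norms add up within that of [Z], and the [v] as rows of [V], each
    of norm at most 1. *)
Lemma low_rank_factor p q r (Z : 'M[R]_(p, q)) : (\rank Z <= r)%N ->
  exists (U : 'M[R]_(p, r)) (V : 'M[R]_(r, q)),
    [/\ Z = U *m V, fnorm U <= fnorm Z & fnorm V ^+ 2 <= r%:R].
Proof.
move=> rZ; suff [U [V [ZUV hU hV]]] : exists (U : 'M[R]_(p, r)) (V : 'M[R]_(r, q)),
    [/\ Z = U *m V, fnorm U ^+ 2 <= fnorm Z ^+ 2 & fnorm V ^+ 2 <= r%:R].
  by exists U, V; split=> //; rewrite -ler_sqr ?nnegrE ?fnorm_ge0.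
elim: r Z rZ => [|r ih] Z.
  rewrite leqn0 mxrank_eq0 => /eqP ->; exists 0, 0.
  by rewrite mul0mx !fnorm0 expr0n/=.
move=> /split_rank_one[u [v [/ih[U [V [ZUV hU hV]]] hv ->]]].
exists (row_mx u U : 'M[R]_(p, 1 + r)), (col_mx v V : 'M[R]_(1 + r, q)); split.
- by apply: etrans (esym (mul_row_col u U v V)); rewrite -ZUV addrC subrK.
- by rewrite [leLHS](sqr_fnorm_row_mx u U) addrC lerD2r.
- by rewrite [leLHS](sqr_fnorm_col_mx v V) -natr1 addrC lerD.
Qed.

(** [Z2] is what remains after peeling off [a] rank-one terms; by Pythagoras each removal can only
    decrease the norm. *)
Lemma low_rank_split p q a b (Z : 'M[R]_(p, q)) : (\rank Z <= a + b)%N ->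
  exists Z2 : 'M[R]_(p, q),
    [/\ (\rank (Z - Z2)%R <= a)%N, (\rank Z2 <= b)%N & fnorm Z2 <= fnorm Z].
Proof.
elim: a Z => [|a ih] Z; first by move=> rZ; exists Z; rewrite subrr mxrank0.
rewrite addSn => /split_rank_one[u [v [/ih[Z2 [ra rb hZ2]] _ hZ]]].
exists Z2; split=> //.
  have -> : Z - Z2 = u *m v + (Z - u *m v - Z2) by rewrite addrA addrCA subrr addr0.
  apply: leq_trans (mxrank_add _ _) (leq_add (n1 := 1) _ ra).
  exact: leq_trans (mxrankM_maxl _ _) (rank_leq_col _).
apply: (le_trans hZ2); rewrite -ler_sqr ?nnegrE ?fnorm_ge0// hZ.
by rewrite lerDl sqr_ge0.
Qed.

End low_rank_matrices.

(** * Rounding and nets *)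

Section rounding.
Context {R : realType}.
Implicit Type h : R.

(** Rounding down leaves a nonnegative error and rounding up a nonpositive one; the sign of [c]
    decides. *)
Lemma round_against h (x c : R) : 0 < h ->
  exists k : int, `|x - h * k%:~R| <= h /\ (x - h * k%:~R) * c <= 0.
Proof.
move=> h0; set k := Num.floor (x / h).
have k1 : k%:~R * h <= x by rewrite -ler_pdivlMr// floor_le_tmp.
have k2 : x < (k + 1)%:~R * h by rewrite -ltr_pdivrMr// floorD1_gt.
rewrite intrD in k2; have [c0|c0] := lerP c 0.
  exists k; split; first by rewrite ler_norml; apply/andP; split; nra.
  by rewrite mulr_ge0_le0//; lra.
exists (k + 1); rewrite intrD; split; first by rewrite ler_norml; apply/andP; split; nra.
by rewrite mulr_le0_ge0 ?ltW//; nra.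
Qed.

(* Rounding the coefficients one at a time, each up or down so that its error
   has nonpositive inner product with the error accumulated so far, the squared
   errors add up as if they were orthogonal. *)
Lemma round_row h q t (X : 'rV[R]_q) (Y : 'M[R]_(q, t)) : 0 < h ->
  exists K : 'rV[int]_q, (forall j, `|X 0 j - h * (K 0 j)%:~R| <= h) /\
    fnorm ((X - h *: map_mx intr K) *m Y) ^+ 2 <= h ^+ 2 * fnorm Y ^+ 2.
Proof.
move=> h0; elim: q X Y => [|q ih] X Y.
  exists 0; split; first by case.
  by rewrite (flatmx0 Y) mulmx0 fnorm0 expr0n mulr_ge0// ?sqr_ge0.
rewrite -(@hsubmxK _ 1 1 q X) -(@vsubmxK _ 1 q t Y).
move: (lsubmx _) (rsubmx _) (usubmx _) (dsubmx _) => x {}X y {}Y.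
have [K [XK hK]] := ih X Y; set v := _ *m Y in hK.
have [k [xk kc]] := round_against (x 0 0) (\sum_l y 0 l * v 0 l) h0.
exists (row_mx (k%:M : 'M[int]_1) K : 'M[int]_(1, 1 + q)); split.
  move=> j; case: (@split_ordP 1 q j) => j' ->.
    by rewrite (row_mxEl x X 0) (row_mxEl k%:M K 0) !ord1 mxE eqxx mulr1n.
  by rewrite (row_mxEr x X 0) (row_mxEr k%:M K 0).
have -> : (row_mx x X - h *: map_mx intr (row_mx (k%:M : 'M[int]_1) K)) *m col_mx y Y =
    (x 0 0 - h * k%:~R) *: y + v.
  rewrite map_row_mx scale_row_mx opp_row_mx add_row_mx mul_row_col; congr (_ + _).
  by rewrite -[RHS]mul_scalar_mx; congr (_ *m _); apply/matrixP => i j; rewrite !ord1 !mxE eqxx !mulr1n.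
rewrite (sqr_fnorm_col_mx y Y) mulrDr.
set e := _ - _ in xk kc *.
have -> : fnorm (e *: y + v) ^+ 2 =
    e ^+ 2 * fnorm y ^+ 2 + e * (\sum_l y 0 l * v 0 l) *+ 2 + fnorm v ^+ 2.
  rewrite !sqr_fnorm !big_ord1 !mulr_sumr -sumrMnl -!big_split/=.
  by apply: eq_bigr => l _; rewrite !mxE; ring.
have eh : e ^+ 2 <= h ^+ 2 by rewrite -real_normK ?num_real// ler_sqr ?nnegrE// ltW.
rewrite lerD// -[leRHS]addr0 lerD ?ler_wpM2r ?sqr_ge0//.
by rewrite -mulr_natr mulr_le0_ge0.
Qed.

Lemma round_mx h p q t (X : 'M[R]_(p, q)) (Y : 'M[R]_(q, t)) : 0 < h ->
  exists K : 'M[int]_(p, q), (forall i j, `|X i j - h * (K i j)%:~R| <= h) /\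
    fnorm ((X - h *: map_mx intr K) *m Y) ^+ 2 <= h ^+ 2 * p%:R * fnorm Y ^+ 2.
Proof.
move=> h0; have /choice[K hK] := fun i => round_row (row i X) Y h0.
exists (\matrix_(i, j) K i 0 j); split.
  by move=> i j; have := (hK i).1 j; rewrite !mxE.
rewrite sqr_fnorm (_ : h ^+ 2 * _ * _ = \sum_(i < p) h ^+ 2 * fnorm Y ^+ 2); last first.
  by rewrite sumr_const card_ord -[RHS]mulr_natr mulrAC.
apply: ler_sum => i _; apply: le_trans (hK i).2.
rewrite sqr_fnorm big_ord1 le_eqVlt; apply/orP; left; apply/eqP.
by apply: eq_bigr => l _; rewrite !mxE; congr (_ ^+ 2); apply: eq_bigr => j _; rewrite !mxE.
Qed.

(** Each coordinate satisfies [|K| <= |X| / h + 1], and Cauchy-Schwarz passes from the l1 norm of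
    [X] to its Frobenius norm. *)
Lemma sum_norm_rounding h p q (X : 'M[R]_(p, q)) (K : 'M[int]_(p, q)) : 0 < h ->
  (forall i j, `|X i j - h * (K i j)%:~R| <= h) ->
  \sum_(k : 'I_p * 'I_q) `|(K k.1 k.2)%:~R : R| <=
    Num.sqrt (p * q)%:R * fnorm X / h + (p * q)%:R.
Proof.
move=> h0 XK.
apply: (@le_trans _ _ (\sum_(k : 'I_p * 'I_q) (`|X k.1 k.2| / h + 1))).
  apply: ler_sum => k _; rewrite -(ler_pM2r h0) mulrDl mul1r divfK ?gt_eqF//.
  rewrite -[h in _ * h]gtr0_norm// -normrM mulrC.
  have -> : h * (K k.1 k.2)%:~R = X k.1 k.2 - (X k.1 k.2 - h * (K k.1 k.2)%:~R) by ring.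
  by rewrite (le_trans (ler_normB _ _))// lerD2l.
rewrite big_split/= -mulr_suml sumr_const card_prod !card_ord lerD2r.
rewrite ler_pM2r ?invr_gt0//.
by have := sum_norm_le_enorm (fun k : 'I_p * 'I_q => X k.1 k.2); rewrite card_prod !card_ord.
Qed.

End rounding.

(** * Counting integer points in an l1-ball *)

Section integer_codes.
Context {R : realType} (I : finType) (N : nat).

(** A coordinate is coded by a sign bit and an absolute value, which keeps the ambient type finite;
    zero has two codes, harmless for an upper count. *)
Definition l1_ball : {set {ffun I -> bool * 'I_N.+1}} :=
  [set f : {ffun I -> bool * 'I_N.+1} | (\sum_i (f i).2 <= N)%N].

(** Weight each code by [2 ^+ N] times the product of [2 ^-1 ^+ (f i).2]: points of the ball weigh
    at least 1, and the total weight factorises into geometric sums, at most 4 per coordinate with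
    both signs. *)
Lemma card_l1_ball : #|l1_ball|%:R <= 2 ^+ N * 4 ^+ #|I| :> R.
Proof.
have geo n : \sum_(k < n.+1) (2 ^-1) ^+ k = 2 - 2 ^-1 ^+ n :> R.
  elim: n => [|n ih]; first by rewrite big_ord_recl big_ord0/= !expr0; ring.
  by rewrite big_ord_recr/= ih !exprS; field.
apply: (@le_trans _ _ (\sum_(f : {ffun I -> bool * 'I_N.+1})
    2 ^+ N * \prod_i (2 ^-1) ^+ (f i).2)).
  rewrite -sum1_card natr_sum big_mkcond/=; apply: ler_sum => f _; rewrite prodrXr.
  rewrite exprVn; case: ifPn => [|_]; last by rewrite mulr_ge0// ?invr_ge0 exprn_ge0.
  by rewrite inE => fN; rewrite ler_pdivlMr ?exprn_gt0// mul1r ler_weXn2l// ler1n.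
rewrite -mulr_sumr ler_pM2l ?exprn_gt0//.
rewrite -(bigA_distr_bigA (fun _ (c : bool * 'I_N.+1) => 2 ^-1 ^+ c.2)) prodr_const.
rewrite lerXn2r ?nnegrE//; first by apply: sumr_ge0 => c _; rewrite exprn_ge0 ?invr_ge0.
rewrite -(pair_bigA _ (fun _ (k : 'I_N.+1) => 2 ^-1 ^+ k))/= big_bool/= geo.
have : 0 <= 2 ^-1 ^+ N :> R by rewrite exprn_ge0 ?invr_ge0.
by lra.
Qed.

Definition code_val (c : bool * 'I_N.+1) : R := (-1) ^+ c.1 * c.2%:R.

Lemma l1_ball_code (K : I -> int) : \sum_i `|(K i)%:~R : R| <= N%:R ->
  exists2 f, f \in l1_ball & forall i, code_val (f i) = (K i)%:~R.
Proof.
move=> KN.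
have KNnat : (\sum_i `|K i| <= N)%N.
  rewrite -(ler_nat R) natr_sum; apply: le_trans KN.
  by apply: ler_sum => i _; rewrite -intr_norm natr_absz.
have Ki i : (`|K i| < N.+1)%N.
  by rewrite ltnS; apply: leq_trans KNnat; rewrite (bigD1 i)//= leq_addr.
exists [ffun i => (K i < 0, Ordinal (Ki i))].
  by rewrite inE; under eq_bigr do rewrite ffunE.
by move=> i; rewrite ffunE /code_val/= [X in _ = X%:~R]intEsign intrM rmorph_sign.
Qed.

End integer_codes.

Section low_rank_net.
Context {R : realType} (s r N : nat) (eps : R).
Hypotheses (s_gt0 : (0 < s)%N) (r_gt0 : (0 < r)%N) (eps01 : 0 < eps <= 1).
Hypothesis N_large : (2 / eps + 1) * (s * r)%:R <= N%:R.

Local Notation code := {ffun 'I_s * 'I_r -> bool * 'I_N.+1}.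

Definition code_mx (h : R) (f : code) : 'M[R]_(s, r) :=
  \matrix_(i, j) (h * code_val (f (i, j))).

(** [f] codes the left factor and [g] the transposed right factor. The finer mesh of the left factor
    needs the larger l1 radius, which is the one required in [N_large]. *)
Definition net_pt (f g : code) : 'M[R]_s :=
  code_mx (eps / (2 * Num.sqrt (s * r)%:R)) f *m (code_mx (eps / Num.sqrt s%:R) g)^T.

Lemma rank_net_pt f g : (\rank (net_pt f g) <= r)%N.
Proof. exact: leq_trans (mxrankM_maxl _ _) (rank_leq_col _). Qed.

Let code_round (h b : R) (X : 'M[R]_(s, r)) (K : 'M[int]_(s, r)) : 0 < h ->
  (forall i j, `|X i j - h * (K i j)%:~R| <= h) -> fnorm X <= b ->
  Num.sqrt (s * r)%:R * b / h + (s * r)%:R <= N%:R ->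
  exists2 f, f \in l1_ball _ N & code_mx h f = h *: map_mx intr K.
Proof.
move=> h0 XK Xb bN.
have [f fB fK] := @l1_ball_code R _ N (fun k : 'I_s * 'I_r => K k.1 k.2) (le_trans
  (le_trans (sum_norm_rounding h0 XK) (lerD (ler_wpM2r (ltW (eq_ind_r _ h0 (invr_gt0 h)))
    (ler_wpM2l (sqrtr_ge0 _) Xb)) (lexx _))) bN).
by exists f => //; apply/matrixP => i j; rewrite !mxE fK.
Qed.

(* If Z = U V with |U| <= 1 and |V|^2 <= r, rounding V against U at mesh
   eps / sqrt s and then U against the rounded V at mesh eps / (2 sqrt (s r))
   costs eps in Frobenius norm each, while the integer coordinates have l1 norm
   of order s r / eps, so that only exp(O(s r)) of them occur. *)
Lemma net_cover (Z : 'M[R]_s) : (\rank Z <= r)%N -> fnorm Z <= 1 ->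
  exists f g, [/\ f \in l1_ball _ N, g \in l1_ball _ N &
    fnorm (Z - net_pt f g) <= 2 * eps].
Proof.
move=> rZ Z1; have /andP[e0 e1] := eps01.
have [U [V [ZUV UZ Vr]]] := low_rank_factor rZ.
have U1 : fnorm U <= 1 by exact: le_trans Z1.
set qs : R := Num.sqrt s%:R; set qr : R := Num.sqrt r%:R.
have s0 : 0 < s%:R :> R by rewrite ltr0n.
have r0 : 0 < r%:R :> R by rewrite ltr0n.
have qs0 : 0 < qs by rewrite sqrtr_gt0.
have eps0 : 0 <= eps := ltW e0.
have qr0 : 0 < qr by rewrite sqrtr_gt0.
have qr0' : 0 <= qr := ltW qr0.
have qs2 : qs ^+ 2 = s%:R by rewrite sqr_sqrtr// ltW.
have qr2 : qr ^+ 2 = r%:R by rewrite sqr_sqrtr// ltW.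
have qsrE : Num.sqrt (s * r)%:R = qs * qr :> R by rewrite natrM sqrtrM// ltW.
pose h := eps / qs; pose h' := eps / (2 * (qs * qr)).
have h0 : 0 < h by rewrite divr_gt0.
have h'0 : 0 < h' by rewrite divr_gt0// !mulr_gt0.
have Vqr : fnorm V <= qr by rewrite -ler_sqr ?nnegrE ?fnorm_ge0// qr2.
have [K [VK hK]] := round_mx V^T U^T h0.
have [||g gB gK] := code_round h0 VK (b := qr); first by rewrite fnorm_tr.
  apply: le_trans N_large; rewrite qsrE natrM -qs2 -qr2 /h.
  rewrite le_eqVlt orbC; apply/orP; left.
  rewrite -subr_gt0 (_ : _ - _ = qs ^+ 2 * qr ^+ 2 / eps).
    by rewrite divr_gt0// mulr_gt0// exprn_gt0.
  by field; rewrite !gt_eqF.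
set V' : 'M[R]_(r, s) := (code_mx h g)^T.
have UVV : fnorm (U *m V - U *m V') <= eps.
  rewrite -mulmxBr -fnorm_tr trmx_mul linearB/= /V' trmxK gK.
  rewrite -ler_sqr ?nnegrE ?fnorm_ge0//; apply: (le_trans hK).
  rewrite fnorm_tr /h exprMn exprVn qs2 divfK ?gt_eqF//.
  by rewrite ler_piMr ?sqr_ge0// expr_le1// fnorm_ge0.
(* The entrywise error bound and [eps <= 1] give [fnorm V' <= 2 * qr]; this 2 is compensated by the
   2 in the mesh [h']. *)
have VV' : fnorm (V - V') <= eps * qr.
  rewrite -ler_sqr ?nnegrE ?fnorm_ge0 ?mulr_ge0//.
  rewrite -fnorm_tr linearB/= /V' trmxK gK.
  apply: (le_trans (fnorm_le_entries (ltW h0) _)).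
    by move=> i j; have := VK i j; rewrite !mxE.
  rewrite natrM -qs2 -qr2 le_eqVlt; apply/orP; left; apply/eqP; rewrite /h.
  by field; rewrite gt_eqF.
have V'2 : fnorm V' <= 2 * qr.
  have -> : V' = V + - (V - V') by rewrite opprB addrC subrK.
  rewrite (le_trans (fnormD _ _))// fnormN.
  by rewrite mulrDl mul1r lerD// (le_trans VV')// ler_piMl.
have [K' [UK' hK']] := round_mx U V' h'0.
have [|f fB fK'] := code_round h'0 UK' U1.
  apply: le_trans N_large; rewrite qsrE natrM -qs2 -qr2 /h'.
  rewrite le_eqVlt; apply/orP; left; apply/eqP.
  by field; rewrite !gt_eqF.
exists f, g; split=> //; rewrite /net_pt qsrE -/qs -/h -/h' -/V'.
have -> : Z - code_mx h' f *m V' = (U *m V - U *m V') + (U - code_mx h' f) *m V'.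
  by rewrite mulmxBl addrA subrK -ZUV.
rewrite (le_trans (fnormD _ _))// mulrDl mul1r lerD// fK'.
rewrite -ler_sqr ?nnegrE ?fnorm_ge0//; apply: (le_trans hK').
apply: (@le_trans _ _ (h' ^+ 2 * s%:R * (2 * qr) ^+ 2)).
  apply: ler_wpM2l; first by rewrite mulr_ge0// sqr_ge0.
  by rewrite ler_sqr ?nnegrE ?fnorm_ge0 ?mulr_ge0.
rewrite -qs2 le_eqVlt; apply/orP; left; apply/eqP; rewrite /h'.
by field; rewrite !gt_eqF.
Qed.

End low_rank_net.

(** * Passing from a net to all matrices of rank at most r *)

Section seminorm_on_net.
Context {R : realType} (s r : nat) (nu : 'M[R]_s -> R) (D : set 'M[R]_s) (eta : R).
Hypothesis eta_bound : 0 < eta <= 1 / 12.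
Hypothesis nuD : forall X Y, nu (X + Y) <= nu X + nu Y.
Hypothesis nuZ : forall a X, nu (a *: X) = `|a| * nu X.
Hypothesis nu_bounded : exists K, forall X, nu X <= K * fnorm X.
Hypothesis D_rank : forall X, D X -> (\rank X <= r)%N.
Hypothesis D_cover : forall Z, (\rank Z <= r)%N -> fnorm Z <= 1 ->
  exists2 X, D X & fnorm (Z - X) <= eta.
Hypothesis D_isometry : forall X, D X ->
  (1 - eta) * fnorm X <= nu X <= (1 + eta) * fnorm X.

Let ball : set R := [set nu Z | Z in [set Z | (\rank Z <= r)%N /\ fnorm Z <= 1]].

Let ball_neq0 : ball !=set0.
Proof. by exists (nu 0), 0 => //=; rewrite mxrank0 fnorm0. Qed.

Let M := sup ball.

Let nu0 : nu 0 = 0.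
Proof. by rewrite -(scale0r 0) nuZ normr0 mul0r. Qed.

(** [nu_bounded] makes [M] a genuine supremum; its size is controlled only in [M_le]. *)
Let ball_ub Z : (\rank Z <= r)%N -> fnorm Z <= 1 -> nu Z <= M.
Proof.
move=> rZ Z1; apply: sup_upper_bound; last by exists Z.
split=> //; have [K hK] := nu_bounded; exists (Num.max K 0) => _ [X [rX X1] <-].
rewrite (le_trans (hK X))// (@le_trans _ _ (Num.max K 0 * fnorm X))//.
  by rewrite ler_wpM2r ?fnorm_ge0// le_max lexx.
by rewrite ler_piMr// le_max lexx orbT.
Qed.

Let M_ge0 : 0 <= M.
Proof. by rewrite -nu0 ball_ub ?mxrank0 ?fnorm0. Qed.

Let normalize (Z : 'M[R]_s) : exists2 Z', Z = fnorm Z *: Z' &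
  (\rank Z' <= \rank Z)%N /\ (Z = 0 \/ fnorm Z' = 1).
Proof.
have [Z0|Z0] := eqVneq (fnorm Z) 0.
  have {}Z0 : Z = 0 by apply/matrixP => i j; rewrite mxE; exact: enorm_eq0 Z0 (i, j).
  by exists 0; [rewrite scaler0|rewrite mxrank0; split => //; left].
exists ((fnorm Z)^-1 *: Z); first by rewrite scalerA mulfV// scale1r.
split; first exact/mxrankS/scalemx_sub.
by right; rewrite fnormZ ger0_norm ?invr_ge0 ?fnorm_ge0// mulVf.
Qed.

Let nu_le_M Z : (\rank Z <= r)%N -> nu Z <= M * fnorm Z.
Proof.
move=> rZ; have [Z' ZE [rZ' hZ']] := normalize Z.
rewrite {1}ZE nuZ ger0_norm ?fnorm_ge0// mulrC.
case: hZ' => [->|Z'1]; first by rewrite fnorm0 !mulr0.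
by rewrite ler_wpM2r ?fnorm_ge0// ball_ub// ?Z'1//; exact: leq_trans rZ.
Qed.

(* Differences of matrices of rank r have rank 2r; they are split into two
   pieces of rank r, to which the definition of M applies. *)
Let nu_diff X Y : (\rank X <= r)%N -> (\rank Y <= r)%N ->
  nu (X - Y) <= 3 * M * fnorm (X - Y).
Proof.
move=> rX rY; have : (\rank (X - Y)%R <= r + r)%N.
  by rewrite (leq_trans (mxrank_add _ _))// leq_add// mxrank_opp.
move=> /low_rank_split[Z2 [r1 r2 hZ2]].
have -> : nu (X - Y) = nu ((X - Y - Z2) + Z2) by rewrite subrK.
have h1 := nu_le_M r1; have h2 := nu_le_M r2.
have h3 : fnorm (X - Y - Z2) <= fnorm (X - Y) + fnorm Z2.
  by rewrite (le_trans (fnormD _ _))// fnormN.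
rewrite (le_trans (nuD _ _))// (le_trans (lerD h1 h2))// -mulrDr -mulrA mulrCA.
by rewrite ler_wpM2l//; lra.
Qed.

Let M_le : M <= 1 + 9 * eta.
Proof.
have /andP[e0 e12] := eta_bound.
(* As [eta <= 1 / 12], this first forces [M <= 2]; reinserting that value on the right gives at most
   [1 + 8 * eta + eta ^+ 2]. *)
suff : M <= (1 + eta) ^+ 2 + 3 * M * eta.
  move=> h; have : M <= 2 by nra.
  by nra.
apply: ge_sup => // _ [Z [rZ Z1] <-].
have [X DX ZX] := D_cover rZ Z1; have rX := D_rank DX.
have -> : nu Z = nu (X + (Z - X)) by rewrite addrC subrK.
rewrite (le_trans (nuD _ _))// lerD//; last first.
  by rewrite (le_trans (nu_diff rZ rX))// ler_wpM2l// mulr_ge0.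
have /andP[_ h] := D_isometry DX; rewrite (le_trans h)// expr2.
rewrite ler_wpM2l; [by []|by lra|].
have -> : X = Z + - (Z - X) by rewrite opprB addrC subrK.
by rewrite (le_trans (fnormD _ _))// fnormN lerD.
Qed.

(** The upper bound is [M_le]. For the lower one, a unit matrix within [eta] of a net point [X] has
    [nu] at least [(1 - eta) * fnorm X - 3 * M * eta], where [fnorm X >= 1 - eta] and [M <= 2]. *)
Lemma seminorm_isometry_from_net (Z : 'M[R]_s) : (\rank Z <= r)%N ->
  (1 - 10 * eta) * fnorm Z <= nu Z <= (1 + 10 * eta) * fnorm Z.
Proof.
move=> rZ; have /andP[e0 e12] := eta_bound; apply/andP; split; last first.
  rewrite (le_trans (nu_le_M rZ))// ler_wpM2r ?fnorm_ge0// (le_trans M_le)//; lra.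
have [Z' ZE [rZ' hZ']] := normalize Z.
rewrite {2}ZE nuZ ger0_norm ?fnorm_ge0// mulrC.
case: hZ' => [->|Z'1]; first by rewrite fnorm0 !mul0r.
rewrite ler_wpM2l ?fnorm_ge0//; have {}rZ' := leq_trans rZ' rZ.
have [X DX ZX] : exists2 X, D X & fnorm (Z' - X) <= eta by apply: D_cover; rewrite ?Z'1.
have rX := D_rank DX.
have XZ : fnorm (X - Z') <= eta by rewrite -fnormN opprB.
have h1 : nu X <= nu Z' + nu (X - Z').
  by have := nuD Z' (X - Z'); rewrite [Z' + _]addrC subrK.
have h2 := nu_diff rX rZ'.
have h3 : 1 <= fnorm X + eta.
  rewrite -Z'1 {1}(_ : Z' = X + (Z' - X)); last by rewrite addrC subrK.
  by rewrite (le_trans (fnormD _ _))// lerD2l.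
have /andP[h4 _] := D_isometry DX.
have h5 : 3 * M * fnorm (X - Z') <= 6 * eta.
  have M2 : M <= 2 by have := M_le; lra.
  have := fnorm_ge0 (X - Z'); nra.
have h6 : (1 - eta) * (1 - eta) <= (1 - eta) * fnorm X by rewrite ler_wpM2l//; lra.
nra.
Qed.

End seminorm_on_net.

(** * Counting supports *)

Section binomial_bound.
Context {R : realType}.

(** A weak Stirling bound, by induction from [(1 + 1 / s) ^ s <= e]. *)
Lemma exprn_self_le_fact s : s%:R ^+ s <= expR s%:R * s`!%:R :> R.
Proof.
elim: s => [|s ih]; first by rewrite expR0 fact0 mulr1 expr0.
have [->|s0] := posnP s; first by rewrite expr1 mulr1; have := @expR_ge1Dx R 1; lra.
have sR : 0 < s%:R :> R by rewrite ltr0n.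
have -> : (s.+1)%:R = s%:R * (1 + s%:R^-1) :> R by rewrite mulrDr mulr1 mulfV ?gt_eqF// natr1.
rewrite exprSr exprMn.
have h : (1 + s%:R^-1) ^+ s <= expR 1 :> R.
  apply: (@le_trans _ _ (expR (s%:R^-1) ^+ s)).
    by rewrite lerXn2r ?nnegrE ?expR_ge0 ?expR_ge1Dx// addr_ge0// invr_ge0.
  by rewrite -expRM_natr mulVf ?gt_eqF.
have -> : s%:R * (1 + s%:R^-1) = s.+1%:R :> R by rewrite mulrDr mulr1 mulfV ?gt_eqF// natr1.
rewrite -natr1 expRD factS natrM -natr1 mulrA [leRHS]mulrAC ler_wpM2r ?addr_ge0//.
rewrite mulrAC; apply: (le_trans (ler_pM _ _ ih h)); rewrite ?exprn_ge0 ?addr_ge0 ?invr_ge0//.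
Qed.

Lemma ln_eM_ge1 n s : (0 < s <= n)%N -> 1 <= ln (expR 1 * n%:R / s%:R) :> R.
Proof.
move=> /andP[s0 sn]; rewrite -[leLHS]expRK ler_ln ?posrE ?expR_gt0//.
  by rewrite -mulrA ler_peMr ?expR_ge0// ler_pdivlMr ?ltr0n// mul1r ler_nat.
by rewrite divr_gt0 ?mulr_gt0 ?expR_gt0 ?ltr0n// (leq_trans s0).
Qed.

(** The right-hand side is [(e n / s) ^ s]: the binomial coefficient times [s!] is a falling
    factorial, at most [n ^ s], and Stirling's bound replaces [s!]. *)
Lemma bin_le_expR n s : (0 < s <= n)%N ->
  ('C(n, s))%:R <= expR (s%:R * ln (expR 1 * n%:R / s%:R)) :> R.
Proof.
move=> /andP[s0 sn].
have sR : 0 < s%:R :> R by rewrite ltr0n.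
have nR : 0 < n%:R :> R by rewrite ltr0n (leq_trans s0).
rewrite expRM_natl lnK ?posrE ?divr_gt0 ?mulr_gt0 ?expR_gt0//.
rewrite !exprMn exprVn -expRM_natl mulr1.
rewrite ler_pdivlMr ?exprn_gt0//.
apply: (@le_trans _ _ ('C(n, s)%:R * (expR s%:R * s`!%:R))).
  by rewrite ler_wpM2l// exprn_self_le_fact.
rewrite mulrCA ler_wpM2l ?expR_ge0// -natrM bin_ffact -natrX ler_nat.
rewrite ffact_prod -[X in (_ <= _ ^ X)%N](card_ord s) -prod_nat_const.
by apply: leq_prod => i _; exact: leq_subr.
Qed.

End binomial_bound.

(** * From the net to all bisparse matrices *)

Lemma frob_normE {R : realType} {n : nat} (X : 'M[R]_n) : frob_norm X = fnorm X.
Proof.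
apply/eqP; rewrite -(@eqrXn2 _ 2)// ?sqrtr_ge0 ?fnorm_ge0//.
by rewrite sqr_frob_norm sqr_enorm.
Qed.

Lemma l2_normE {R : realType} {m : nat} (x : 'rV[R]_m) : l2_norm x = fnorm x.
Proof.
apply/eqP; rewrite -(@eqrXn2 _ 2)// ?sqrtr_ge0 ?fnorm_ge0//.
by rewrite sqr_l2_norm sqr_fnorm big_ord1.
Qed.

(** * Measurability of the isometry event *)

Section measurability.
Context {R : realType} {n : nat}.
Implicit Types (Z : 'M[R]_n) (Sig : set 'M[R]_n).

(** Each of the countably many grid cells that meets [Sig] contributes one chosen point of [Sig];
    other cells contribute [Z0]. The factor 2 comes from going from [Z] to its grid point and on to
    the chosen one. *)
Lemma entrywise_dense_sequence Sig : Sig !=set0 ->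
  exists g : nat -> 'M[R]_n, (forall k, Sig (g k)) /\
    forall Z, Sig Z -> exists u : nat -> nat,
      forall k i j, `|Z i j - g (u k) i j| <= 2 * k.+1%:R^-1.
Proof.
move=> [Z0 SZ0].
pose near (c : 'M[int]_n * nat) Z :=
  forall i j, `|Z i j - (c.1 i j)%:~R * c.2.+1%:R^-1| <= c.2.+1%:R^-1.
have /choice[g0 hg0] (c : 'M[int]_n * nat) : exists Y, Sig Y /\
    ((exists Y', Sig Y' /\ near c Y') -> near c Y).
  have [[Y' [SY' cY']]|h] := pselect (exists Y', Sig Y' /\ near c Y').
    by exists Y'.
  by exists Z0; split => // /h.
exists (fun k => g0 (odflt (0, 0%N) (unpickle k))); split => [k|Z SZ].
  exact: (hg0 _).1.
pose Q k : 'M[int]_n := \matrix_(i, j) Num.floor (Z i j / k.+1%:R^-1).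
have nearQ k : near (Q k, k) Z.
  move=> i j; rewrite /= mxE; set h := k.+1%:R^-1; set q := Num.floor _.
  have h0 : 0 < h :> R by rewrite invr_gt0.
  have q1 : q%:~R * h <= Z i j by rewrite -ler_pdivlMr// floor_le_tmp.
  have q2 : Z i j < (q + 1)%:~R * h by rewrite -ltr_pdivrMr// floorD1_gt.
  by rewrite intrD mulrDl mul1r in q2; rewrite ler_norml; apply/andP; split; lra.
exists (fun k => pickle (Q k, k)) => k i j; rewrite pickleK/=.
have h1 := nearQ k i j.
have h2 : near (Q k, k) (g0 (Q k, k)) by apply: (hg0 _).2; exists Z.
have := h2 i j => {}h2; rewrite mulrDl mul1r.
rewrite -(subrKA ((Q k i j)%:~R * k.+1%:R^-1)) (le_trans (ler_normD _ _))// lerD//.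
by rewrite distrC.
Qed.

Lemma cvg_sumr {I : Type} (s : seq I) (f : I -> nat -> R) (l : I -> R) :
  (forall i, f i k @[k --> \oo] --> l i) ->
  \sum_(i <- s) f i k @[k --> \oo] --> \sum_(i <- s) l i.
Proof.
move=> fl; elim: s => [|i s ih].
  by rewrite big_nil; under eq_fun do rewrite big_nil; exact: cvg_cst.
by rewrite big_cons; under eq_fun do rewrite big_cons; exact: cvgD.
Qed.

(** The intersection over [Sig] is uncountable, but both sides of the inequalities are continuous in
    [Z], so a dense sequence within [Sig] suffices. *)
Lemma measurable_isometry_event m d (T : measurableType d) (A : 'I_m -> T -> 'M[R]_n)
    Sig (a b : R) : Sig !=set0 ->
  (forall Z, measurable_fun setT
    (fun w => l2_norm (measurement_map (A ^~ w) Z) ^+ 2)) ->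
  measurable [set w | forall Z, Sig Z ->
    (a * frob_norm Z ^+ 2 <= l2_norm (measurement_map (A ^~ w) Z) ^+ 2 <=
     b * frob_norm Z ^+ 2)%R].
Proof.
move=> Sig0 mA; have [g [gSig gdense]] := entrywise_dense_sequence Sig0.
rewrite (_ : [set w | _] = \bigcap_k [set w |
    (a * frob_norm (g k) ^+ 2 <= l2_norm (measurement_map (A ^~ w) (g k)) ^+ 2 <=
     b * frob_norm (g k) ^+ 2)%R]).
  apply: bigcapT_measurable => k.
  rewrite (_ : [set w | _] =
    [set w | (a * frob_norm (g k) ^+ 2 <= l2_norm (measurement_map (A ^~ w) (g k)) ^+ 2)%R] `&`
    [set w | (l2_norm (measurement_map (A ^~ w) (g k)) ^+ 2 <= b * frob_norm (g k) ^+ 2)%R]).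
    apply: measurableI.
      by rewrite -[X in measurable X]setTI; apply: measurable_fun_le.
    by rewrite -[X in measurable X]setTI; apply: measurable_fun_le.
  by apply/seteqP; split=> w /= => [/andP[]|[-> ->]].
apply/seteqP; split=> w /=; first by move=> h k _; exact: h.
move=> h Z /gdense[u uZ].
have gZ i j : g (u k) i j @[k --> \oo] --> Z i j.
  apply/cvgrPdist_le => e e0.
  have /cvgrPdist_le/(_ _ e0) : 2 * harmonic k @[k --> \oo] --> (2 * 0 : R).
    by apply: cvgM; [exact: cvg_cst|exact: cvg_harmonic].
  apply: filterS => k; rewrite mulr0 sub0r normrN ger0_norm ?mulr_ge0 ?invr_ge0//.
  exact: le_trans.
have frobZ : frob_norm (g (u k)) ^+ 2 @[k --> \oo] --> frob_norm Z ^+ 2.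
  rewrite sqr_frob_norm; under eq_fun do rewrite sqr_frob_norm.
  by apply: cvg_sumr => p; rewrite expr2; under eq_fun do rewrite expr2; exact: cvgM.
have measZ : l2_norm (measurement_map (A ^~ w) (g (u k))) ^+ 2 @[k --> \oo] -->
    l2_norm (measurement_map (A ^~ w) Z) ^+ 2.
  rewrite sqr_l2_norm_measurement; under eq_fun do rewrite sqr_l2_norm_measurement.
  have innerZ i : frob_inner (g (u k)) (A i w) @[k --> \oo] --> frob_inner Z (A i w).
    rewrite frob_innerE; under eq_fun do rewrite frob_innerE.
    by apply: cvg_sumr => p; apply: cvgM => //; exact: cvg_cst.
  by apply: cvg_sumr => i; rewrite expr2; under eq_fun do rewrite expr2; exact: cvgM.
have scaleZ (c : R) : c * frob_norm (g (u k)) ^+ 2 @[k --> \oo] --> c * frob_norm Z ^+ 2.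
  by apply: cvgM => //; exact: cvg_cst.
apply/andP; split.
  by apply: (ler_cvg_to (scaleZ a) measZ); apply: nearW => k; have /andP[] := h (u k) I.
by apply: (ler_cvg_to measZ (scaleZ b)); apply: nearW => k; have /andP[] := h (u k) I.
Qed.

End measurability.

(** * Matrices supported on a square block *)

Section principal_submatrix.
Context {R : realType} {s n : nat} (f : 'I_s -> 'I_n).

Definition sel_mx : 'M[R]_(s, n) := \matrix_(k, i) (f k == i)%:R.

Definition embed_mx (Y : 'M[R]_s) : 'M[R]_n := sel_mx^T *m Y *m sel_mx.

Lemma embed_mxD X Y : embed_mx (X + Y) = embed_mx X + embed_mx Y.
Proof. by rewrite /embed_mx mulmxDr mulmxDl. Qed.

Lemma embed_mxZ a X : embed_mx (a *: X) = a *: embed_mx X.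
Proof. by rewrite /embed_mx -scalemxAr -scalemxAl. Qed.

Hypothesis f_inj : injective f.

Lemma sel_mx_tr : sel_mx *m sel_mx^T = 1%:M.
Proof.
apply/matrixP => k l; rewrite !mxE (bigD1 (f k))//= big1 => [|i /negbTE ik].
  by rewrite !mxE eqxx mul1r addr0 (inj_eq f_inj) eq_sym.
by rewrite !mxE eq_sym ik mul0r.
Qed.

Lemma frob_norm_embed Y : frob_norm (embed_mx Y) = frob_norm Y.
Proof.
congr Num.sqrt; rewrite /frob_inner /embed_mx !trmx_mul trmxK.
rewrite mxtrace_mulC -!mulmxA mulmxA; rewrite -[X in \tr X]mulmxA.
rewrite (mulmxA sel_mx) sel_mx_tr mul1mx mulmxA mxtrace_mulC.
by rewrite -mulmxA (mulmxA sel_mx) sel_mx_tr mul1mx mxtrace_mulC.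
Qed.

(** [sel_mx^T *m sel_mx] is the coordinate projection onto the range of [f], which contains [S]; it
    fixes [Z] from the left and, after transposition, from the right. *)
Lemma embed_bisparse (Z : 'M[R]_n) (S : {set 'I_n}) :
  (forall i, i \in S -> exists k, f k = i) ->
  (forall i j, ~~ ((i \in S) && (j \in S)) -> Z i j = 0) ->
  Z = embed_mx (sel_mx *m Z *m sel_mx^T).
Proof.
move=> fS ZS.
have selZ (B : 'M[R]_(n, n)) : (forall i j, i \notin S -> B i j = 0) ->
    sel_mx^T *m sel_mx *m B = B.
  move=> BS; apply/matrixP => i j; rewrite mxE.
  have [/fS[k fk]|iS] := boolP (i \in S).
    rewrite (bigD1 i)//= big1 => [|l li]; last first.
      rewrite mxE big1 ?mul0r// => k' _; rewrite !mxE.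
      have [fki|_] := eqVneq (f k') i; last by rewrite mul0r.
      by rewrite fki eq_sym (negbTE li) mulr0.
    rewrite mxE (bigD1 k)//= big1 => [|k' k'k]; last first.
      by rewrite !mxE -fk (inj_eq f_inj) (negbTE k'k) mul0r.
    by rewrite !mxE fk eqxx !addr0 !mul1r.
  rewrite [RHS]BS// big1// => l _.
  have [lS|lS] := boolP (l \in S); last by rewrite BS// mulr0.
  rewrite mxE big1 ?mul0r// => k' _; rewrite !mxE.
  have [fki|_] := eqVneq (f k') i; last by rewrite mul0r.
  have [il|_] := eqVneq (f k') l; last by rewrite mulr0.
  by move: iS; rewrite -fki il lS.
have Zr : Z *m (sel_mx^T *m sel_mx) = Z.
  apply: trmx_inj; rewrite trmx_mul trmx_mul trmxK selZ// => i j iS.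
  by rewrite mxE ZS// negb_and iS orbT.
rewrite /embed_mx -!mulmxA (mulmxA sel_mx) -(mulmxA sel_mx Z) Zr mulmxA selZ// => i j iS.
by rewrite ZS// negb_and iS.
Qed.

End principal_submatrix.

Lemma measure_bigsetU_le d (T : measurableType d) (R : realType)
    (mu : {measure set T -> \bar R}) (I : eqType) (s : seq I) (F : I -> set T) (b : R) :
  (forall i, measurable (F i)) -> (forall i, i \in s -> (mu (F i) <= b%:E)%E) ->
  (mu (\big[setU/set0]_(i <- s) F i) <= ((size s)%:R * b)%:E)%E.
Proof.
move=> mF; elim: s => [|i s ih] Fb; first by rewrite big_nil measure0 mul0r.
rewrite big_cons (le_trans (measureU2 _ _ _))//; first exact: bigsetU_measurable.
rewrite /= -natr1 mulrDl mul1r EFinD [leRHS]addeC leeD//; first by apply: Fb; rewrite mem_head.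
by apply: ih => j js; apply: Fb; rewrite inE js orbT.
Qed.

Section isometry_on_a_support.
Context {R : realType} {n m s r N : nat} (A : 'I_m -> 'M[R]_n) (eps : R).

Lemma measurement_mapD X Y :
  measurement_map A (X + Y) = measurement_map A X + measurement_map A Y.
Proof. by apply/rowP => i; rewrite !mxE /frob_inner mulmxDr mxtraceD. Qed.

Lemma measurement_mapZ a X : measurement_map A (a *: X) = a *: measurement_map A X.
Proof. by apply/rowP => i; rewrite !mxE /frob_inner -scalemxAr mxtraceZ. Qed.

Lemma sqr_frob_inner_le (X Y : 'M[R]_n) :
  frob_inner X Y ^+ 2 <= fnorm X ^+ 2 * fnorm Y ^+ 2.
Proof.
rewrite -exprMn -real_normK ?num_real// ler_sqr ?nnegrE ?mulr_ge0 ?fnorm_ge0//.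
rewrite ler_norml lerNl; apply/andP; split; last by rewrite frob_innerE; exact: cauchy_schwarz.
rewrite -(fnormN X) -mulN1r; apply: le_trans (cauchy_schwarz _ _).
rewrite frob_innerE mulr_sumr le_eqVlt; apply/orP; left; apply/eqP.
by apply: eq_bigr => k _; rewrite mxE mulN1r mulNr.
Qed.

(** A crude bound for a fixed realisation of the measurements, supplying the finiteness hypothesis
    [nu_bounded]. *)
Lemma l2_norm_measurement_le (X : 'M[R]_n) :
  l2_norm (measurement_map A X) <= Num.sqrt (\sum_i fnorm (A i) ^+ 2) * fnorm X.
Proof.
rewrite -ler_sqr ?nnegrE ?mulr_ge0 ?sqrtr_ge0 ?fnorm_ge0//.
rewrite sqr_l2_norm_measurement exprMn sqr_sqrtr; last first.
  by apply: sumr_ge0 => i _; exact: sqr_ge0.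
by rewrite mulr_suml; apply: ler_sum => i _; rewrite mulrC sqr_frob_inner_le.
Qed.

Lemma isometry_from_net (f : 'I_s -> 'I_n) : injective f ->
  (0 < s)%N -> (0 < r)%N -> 0 < 2 * eps <= 1 / 12 ->
  (2 / eps + 1) * (s * r)%:R <= N%:R ->
  (forall a b, a \in l1_ball _ N -> b \in l1_ball _ N ->
    let X := embed_mx f (@net_pt R s r N eps a b) in
    (1 - 2 * eps) * frob_norm X ^+ 2 <= l2_norm (measurement_map A X) ^+ 2 <=
    (1 + 2 * eps) * frob_norm X ^+ 2) ->
  forall Y : 'M[R]_s, (\rank Y <= r)%N ->
    (1 - 10 * (2 * eps)) * fnorm Y <= l2_norm (measurement_map A (embed_mx f Y)) <=
    (1 + 10 * (2 * eps)) * fnorm Y.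
Proof.
move=> f_inj s0 r0 /andP[e0 e1] NL net.
apply: (@seminorm_isometry_from_net R s r
  (fun Y => l2_norm (measurement_map A (embed_mx f Y)))
  [set X | exists a b, [/\ a \in l1_ball _ N, b \in l1_ball _ N &
    X = @net_pt R s r N eps a b]] (2 * eps)).
- by rewrite e0 e1.
- by move=> X Y; rewrite embed_mxD measurement_mapD !l2_normE fnormD.
- by move=> a X; rewrite embed_mxZ measurement_mapZ !l2_normE fnormZ.
- exists (Num.sqrt (\sum_i fnorm (A i) ^+ 2)) => X.
  rewrite -[in leRHS]frob_normE -(frob_norm_embed f_inj X) frob_normE.
  exact: l2_norm_measurement_le.
- by move=> _ [a [b [_ _ ->]]]; exact: rank_net_pt.
- move=> Z rZ Z1; have [|a [b [aB bB hab]]] := @net_cover R s r N eps s0 r0 _ NL Z rZ Z1.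
    by apply/andP; split; lra.
  by exists (net_pt eps a b) => //; exists a, b.
- move=> _ [a [b [aB bB ->]]]; have /andP[lo hi] := net a b aB bB.
  rewrite !frob_norm_embed// frob_normE in lo hi.
  set x := fnorm _ in lo hi *; set y := l2_norm _ in lo hi *.
  have x0 : 0 <= x := fnorm_ge0 _.
  have y0 : 0 <= y by rewrite /y l2_normE fnorm_ge0.
  set eta := 2 * eps in e0 e1 lo hi *.
  have eta0 : 0 <= 1 - eta by lra.
  (* The squared estimates imply the unsquared ones because [(1 - eta) ^+ 2 <= 1 - eta] and
     [1 + eta <= (1 + eta) ^+ 2]. *)
  apply/andP; split; rewrite -ler_sqr ?nnegrE ?mulr_ge0//; try lra.
    rewrite exprMn (le_trans _ lo)// ler_wpM2r ?sqr_ge0//.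
    by rewrite expr2 ler_piMr//; lra.
  rewrite exprMn (le_trans hi)// ler_wpM2r ?sqr_ge0//.
  by rewrite expr2 ler_peMr//; lra.
Qed.

End isometry_on_a_support.

(** * Choice of constants and union bound *)

Unset Implicit Arguments.

Theorem theorem2 (R : realType) (delta : R) (delta_gt0 : 0 < delta) :
  exists C c : R, [/\ 0 < C, 0 < c &
    forall n r s m : nat,
      (1 <= n)%N -> (1 <= r <= n)%N -> (1 <= s <= n)%N -> (1 <= m)%N ->
    forall (d : measure_display) (T : measurableType d) (P : probability T R)
      (A : 'I_m -> {RV P >-> borel_mx R n}),
      mutually_independent P (fun i => A i : T -> borel_mx R n) ->
      (forall i : 'I_m, mutually_independent P
         (fun (p : 'I_n * 'I_n) (w : T) => (A i w : 'M[R]_n) p.1 p.2)) ->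
      (forall (i : 'I_m) (j k : 'I_n),
         normally_distributed P (fun w : T => (A i w : 'M[R]_n) j k)
           0 (1 / m%:R)) ->
      C * r%:R * s%:R * ln (expR 1 * n%:R / s%:R) <= m%:R ->
      (P (~` [set w : T | forall Z : 'M[R]_n, bisparse_lowrank s r Z ->
           ((1 - delta) * frob_norm Z ^+ 2 <=
              l2_norm (measurement_map (fun i => A i w : 'M[R]_n) Z) ^+ 2 <=
            (1 + delta) * frob_norm Z ^+ 2)%R])
        <= (2 * expR (- (c * m%:R)))%:E)%E].
Proof.
pose delta0 := Num.min delta 1.
have d00 : 0 < delta0 by rewrite lt_min delta_gt0 ltr01.
have d01 : delta0 <= 1 by rewrite ge_min lexx orbT.
have d0d : delta0 <= delta by rewrite ge_min lexx.
(* The net radius is [eta = delta0 / 100], so the norm distortion is [10 * eta = delta0 / 10]; as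
   [delta0 <= 1], squaring keeps it within [delta0]. *)
pose eps := delta0 / 200; pose eta := 2 * eps.
have eps0 : 0 < eps by rewrite /eps; lra.
have eta0 : 0 < eta <= 1 by rewrite /eta /eps; apply/andP; split; lra.
pose L := (Num.truncn (2 / eps + 1)).+1.
have Leps : 2 / eps + 1 <= L%:R by exact/ltW/truncnS_gt.
pose c1 := eta ^+ 2 / 256.
have c10 : 0 < c1 by rewrite divr_gt0// exprn_gt0//; case/andP: eta0.
(* [kappa = 1 + 2 * (L + 2)]: one unit for the supports and [L + 2] for each of the two codes. *)
pose kappa : R := (2 * L + 5)%:R.
(* This [C] makes the logarithm of the number of net points at most [c1 / 2 * m%:R], half of the
   concentration exponent; the other half is [c]. *)
exists (2 * kappa / c1), (c1 / 2); split.
- by rewrite divr_gt0// mulr_gt0// ltr0n addn_gt0 orbT.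
- by rewrite divr_gt0.
move=> n r s m n0 /andP[r0 rn] /andP[s0 sn] m0 d T P A indA indE normA mC.
set ell := ln _ in mC; have ell1 : 1 <= ell by apply: ln_eM_ge1; rewrite s0.
pose N := (L * (s * r))%N.
have NL : (2 / eps + 1) * (s * r)%:R <= N%:R by rewrite [leRHS]natrM ler_wpM2r.
(* [phi S] enumerates [S]; for sets of another size it is an arbitrary constant map. *)
have /choice[phi hphi] (S : {set 'I_n}) : exists f : 'I_s -> 'I_n, #|S| = s ->
    injective f /\ forall i, i \in S -> exists k, f k = i.
  have [cS|cS] := eqVneq #|S| s; last first.
    by exists (fun=> Ordinal n0) => /eqP; rewrite (negbTE cS).
  exists (fun k => enum_val (cast_ord (esym cS) k)) => _; split.
    by move=> k k' /enum_val_inj /cast_ord_inj.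
  move=> i iS; exists (cast_ord cS (enum_rank_in iS i)).
  by rewrite cast_ordK enum_rankK_in.
pose code := {ffun 'I_s * 'I_r -> bool * 'I_N.+1}.
pose B : {set code} := l1_ball _ N.
pose J := finset.setX (finset.setX [set S : {set 'I_n} | #|S| == s]%SET B) B.
pose pt (x : {set 'I_n} * code * code) : 'M[R]_n :=
  embed_mx (phi x.1.1) (net_pt eps x.1.2 x.2).
pose Aw w i : 'M[R]_n := A i w.
pose bad x := ~` [set w : T | ((1 - eta) * frob_norm (pt x) ^+ 2 <=
  l2_norm (measurement_map (Aw w) (pt x)) ^+ 2 <= (1 + eta) * frob_norm (pt x) ^+ 2)%R].
have mN Z : measurable_fun setT (fun w => l2_norm (measurement_map (Aw w) Z) ^+ 2).
  exact: measurable_sqr_l2_norm_measurement.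
have mbad x : measurable (bad x).
  apply: measurableC; have := @measurable_isometry_event R n m d T (fun i w => Aw w i)
    [set pt x] (1 - eta) (1 + eta) _ mN.
  rewrite (_ : [set w | forall Z, _ Z -> _] = [set w : T | ((1 - eta) * frob_norm (pt x) ^+ 2 <=
    l2_norm (measurement_map (Aw w) (pt x)) ^+ 2 <= (1 + eta) * frob_norm (pt x) ^+ 2)%R]).
    by apply; exists (pt x).
  by apply/seteqP; split=> w /= => [h|h Z ->//]; exact: h.
have Pbad x : (P (bad x) <= (2 * expR (- (c1 * m%:R)))%:E)%E.
  exact: (gaussian_concentration m0 indA indE normA _ eta0).
apply: (@le_trans _ _ (P (\big[setU/set0]_(x <- enum J) bad x))).
  apply: le_measure; rewrite ?inE.
  - apply: measurableC; apply: (measurable_isometry_event (A := fun i w => Aw w i)) => //.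
    exists 0; split; rewrite ?trmx0 ?mxrank0//.
    have /card_gt0P[S] : (0 < #|[set S : {set 'I_n} | #|S| == s]%SET|)%N.
      by rewrite card_draws card_ord bin_gt0.
    by rewrite inE => /eqP cS; exists S; split => // i j _; rewrite mxE.
  - exact: bigsetU_measurable.
  (* Outside all bad events, the compression [Y] of [Z] to its support has rank at most [r], and the
     net of that support is nearly isometric, so [isometry_from_net] applies. *)
  apply: subsetCl; rewrite -bigcup_seq setC_bigcup => w hw Z [_ rZ [S [cS ZS]]].
  have [f_inj fS] := hphi S cS.
  set Y := sel_mx (phi S) *m Z *m (sel_mx (phi S))^T.
  have ZY : Z = embed_mx (phi S) Y := embed_bisparse f_inj fS ZS.
  have rY : (\rank Y <= r)%N.
    by rewrite (leq_trans (mxrankM_maxl _ _))// (leq_trans (mxrankM_maxr _ _)).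
  have net a b : a \in B -> b \in B ->
      let X := embed_mx (phi S) (net_pt eps a b) in
      (1 - 2 * eps) * frob_norm X ^+ 2 <= l2_norm (measurement_map (Aw w) X) ^+ 2 <=
      (1 + 2 * eps) * frob_norm X ^+ 2.
    move=> aB bB; have Sab : [set` enum J] (S, a, b).
      by rewrite /= mem_enum !finset.in_setX inE cS eqxx aB bB.
    by have := hw _ Sab; rewrite /bad setCK.
  have := isometry_from_net f_inj s0 r0 _ NL net rY.
  rewrite -ZY -/eta -frob_normE -(frob_norm_embed f_inj) -ZY.
  have -> : 0 < eta <= 1 / 12 by rewrite /eta /eps; apply/andP; split; lra.
  move=> /(_ isT) /andP[]; rewrite -/(Aw w).
  set x := frob_norm Z; set y := l2_norm _ => lo hi.
  have x0 : 0 <= x by exact: sqrtr_ge0.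
  have y0 : 0 <= y by exact: sqrtr_ge0.
  have etaE : 10 * eta = delta0 / 10 by rewrite /eta /eps; lra.
  rewrite etaE in lo hi.
  have lo2 : ((1 - delta0 / 10) * x) ^+ 2 <= y ^+ 2.
    by rewrite ler_sqr ?nnegrE// mulr_ge0//; lra.
  have hi2 : y ^+ 2 <= ((1 + delta0 / 10) * x) ^+ 2.
    by rewrite ler_sqr ?nnegrE// mulr_ge0//; lra.
  rewrite !exprMn in lo2 hi2; apply/andP; split.
    apply: le_trans lo2; rewrite ler_wpM2r ?sqr_ge0//; nra.
  by apply: (le_trans hi2); rewrite ler_wpM2r ?sqr_ge0//; nra.
apply: (le_trans (measure_bigsetU_le mbad (fun x _ => Pbad x))).
rewrite lee_fin -cardE mulrCA ler_pM2l//.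
(* The count [2 ^+ N * 4 ^+ (s * r)] equals [2 ^+ ((L + 2) * (s * r))], and [2 <= e]. *)
have cB : #|B|%:R <= expR ((L + 2)%:R * (s%:R * r%:R)) :> R.
  apply: (le_trans (card_l1_ball _ _)); rewrite card_prod !card_ord.
  rewrite (_ : 4 = 2 ^+ 2 :> R); last by rewrite -natrX.
  rewrite -exprM -exprD -!natrM -[_%:R in leRHS]mulr1 expRM_natl.
  rewrite (_ : (N + 2 * (s * r) = (L + 2) * (s * r))%N); last by rewrite mulnDl.
  rewrite lerXn2r ?nnegrE ?expR_ge0//.
  by have := @expR_ge1Dx R 1; lra.
(* Since [r >= 1] and [ell >= 1], both [s * ell] from the supports and [s * r] from the codes are
   absorbed into [r * s * ell]. *)
have cJ : #|J|%:R <= expR (kappa * (r%:R * s%:R * ell)) :> R.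
  rewrite !cardsX card_draws card_ord !natrM.
  apply: (@le_trans _ _ (expR (s%:R * ell) * expR ((L + 2)%:R * (s%:R * r%:R)) *
      expR ((L + 2)%:R * (s%:R * r%:R)))).
    apply: ler_pM => //; apply: ler_pM => //; apply: bin_le_expR; by rewrite s0.
  rewrite -!expRD ler_expR.
  have r1 : 1 <= r%:R :> R by rewrite ler1n.
  have s1 : 1 <= s%:R :> R by rewrite ler1n.
  have h1 : s%:R * ell <= r%:R * s%:R * ell.
    by rewrite -mulrA ler_peMl// mulr_ge0//; lra.
  have h2 : s%:R * r%:R <= r%:R * s%:R * ell.
    by rewrite mulrC ler_peMr// mulr_ge0.
  have h3 : (L + 2)%:R * (s%:R * r%:R) <= (L + 2)%:R * (r%:R * s%:R * ell) :> R.
    by rewrite ler_wpM2l.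
  have -> : kappa = 1 + (L + 2)%:R + (L + 2)%:R by rewrite /kappa !natrD natrM; ring.
  by rewrite !mulrDl mul1r !lerD.
apply: (le_trans (ler_wpM2r (expR_ge0 _) cJ)); rewrite -expRD ler_expR.
have h : kappa * (r%:R * s%:R * ell) <= c1 / 2 * m%:R.
  have := ler_wpM2l (ltW c10) mC => h.
  have E : c1 * (2 * kappa / c1 * r%:R * s%:R * ell) = 2 * (kappa * (r%:R * s%:R * ell)).
    by field; rewrite gt_eqF.
  by rewrite E in h; lra.
by lra.
Qed.
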